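(* Let $\varphi$ be an endomorphism of a subshift $(X,\sigma)$. For $\alpha,\beta\in\mathbb R\cup\{\infty,-\infty\}$ the interval $(\alpha,\beta)$ with $\alpha\ge\beta$ means the empty set. If $\varphi$ is onto, then the following (1)–(4) hold. (1) The interval $(-p_L(\varphi),\infty)$ is the set of all right $\sigma$-expansive directions on the upper side for $\varphi$, and it is the right-unbounded connected component of $E_R(\varphi)$. The interval $(-\infty,p_R(\varphi))$ is the set of all left $\sigma$-expansive directions on the upper side for $\varphi$, and it is the left-unbounded connected component of $E_L(\varphi)$. (2) The interval $(-q_R(\varphi),\infty)$ is the set of all positively left $\sigma$-expansive directions for $\varphi$, and it is the right-unbounded component of $E_L(\varphi)$ if it is nonempty. The interval $(-\infty,q_L(\varphi))$ is the set of all positively right $\sigma$-expansive directions for $\varphi$, and it is the left-unbounded component of $E_R(\varphi)$ if it is nonempty. (3) In particular, neither $-p_L(\varphi)$ nor $q_L(\varphi)$ is a right $\sigma$-expansive direction for $\varphi$, and neither $p_R(\varphi)$ nor $-q_R(\varphi)$ is a left $\sigma$-expansive direction for $\varphi$. (4) The interval $(c_R(\varphi),\infty)$ is the right-unbounded component of $E(\varphi)$ if it is nonempty, and $(-\infty,c_L(\varphi))$ is the left-unbounded component of $E(\varphi)$ if it is nonempty. Further, the interval $(-q_R(\varphi),q_L(\varphi))$ is a component of $E(\varphi)$ if it is nonempty. If $\varphi$ is not necessarily onto, then: (5) The interval $(-q_R(\varphi),\infty)$ is the set of all positively left $\sigma$-expansive directions for $\varphi$, the interval $(-\infty,q_L(\varphi))$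 is the set of all positively right $\sigma$-expansive directions for $\varphi$, and the interval $(-q_R(\varphi),q_L(\varphi))$ is the set of all positively expansive directions for $\varphi$.
   Context: **Subshifts.** An alphabet is a finite set with at least two elements. For an alphabet $A$, $A^{\mathbb Z}$ carries the product topology; the shift maps $(a_j)_j$ to $(a_{j+1})_j$. A subshift $(X,\sigma)$ over $A$ is a closed $X\subset A^{\mathbb Z}$ with $\sigma(X)=X$, $\sigma$ being the restricted shift; $d_X$ is a compatible metric; $L_k(X)$ is the set of words of length $k$ occurring in points of $X$. An endomorphism of $(X,\sigma)$ is a continuous map $\varphi:X\to X$ commuting with $\sigma$ (not assumed onto). **Type.** A local rule of neighborhood-size $N\ge 0$ on $X$ is a map $f:L_{N+1}(X)\to L_1(X)$ with $(f(a_j\dots a_{j+N}))_{j\in\mathbb Z}\in X$ for all $(a_j)\in X$. For $m,n\ge0$, $m+n=N$, $\varphi$ is of $(m,n)$-type given by $f$ if $\varphi((a_j)_j)=(f(a_{j-m}\dots a_{j+n}))_j$. Every endomorphism arises this way. **Degrees.** Let $f$ be a local rule of neighborhood-size $N$. It is $I$ left-redundant ($I\ge0$) if for all $(a_j),(b_j)\in X$, $a_j=b_j$ for all $j\ge0$ implies $f(a_{-I}\dots a_{-I+N})=f(b_{-I}\dots b_{-I+N})$; $I$ right-redundant if $a_j=b_j$ for all $j\le0$ implies $f(a_{I-N}\dots a_I)=f(b_{I-N}\dots b_I)$. It is strictly $I$ left-redundant if $I$ left-redundant but not $I+1$ left-redundant, strictly $\infty$ left-redundant if $I$ left-redundant for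 all $I\ge0$; similarly for right. It is $k$ right-mergible ($k\ge0$) if $a_j=b_j$ for $j\le 0$ and $f(a_{j-N}\dots a_j)=f(b_{j-N}\dots b_j)$ for $1\le j\le k+1$ imply $a_1=b_1$; $k$ left-mergible if $a_j=b_j$ for $j\ge0$ and $f(a_{-j}\dots a_{-j+N})=f(b_{-j}\dots b_{-j+N})$ for $1\le j\le k+1$ imply $a_{-1}=b_{-1}$. It is strictly $k$ right-mergible if $k\ge 0$ is the least integer for which it is $k$ right-mergible, strictly $\infty$ right-mergible if there is none; similarly for left. If $\varphi$ is of $(m,n)$-type given by $f$ which is strictly $I$ left-redundant, strictly $J$ right-redundant, strictly $k$ right-mergible and strictly $l$ left-mergible, then $P_L(\varphi)=I-m$, $P_R(\varphi)=J-n$, and, if $X$ is infinite, $Q_R(\varphi)=n-k$, $Q_L(\varphi)=m-l$; if $X$ is finite, $Q_R(\varphi)=Q_L(\varphi)=\infty$. These are independent of the choice of $f$, $m$, $n$. **Limits.** $p_L(\varphi)=\lim_{s\to\infty}P_L(\varphi^s)/s$, $p_R(\varphi)=\lim P_R(\varphi^s)/s$, $q_R(\varphi)=\lim Q_R(\varphi^s)/s$, $q_L(\varphi)=\lim Q_L(\varphi^s)/s$; these limits exist in $\mathbb R\cup\{\pm\infty\}$. For onto $\varphi$, $c_R(\varphi)=\max\{-p_L(\varphi),-q_R(\varphi)\}$ and $c_L(\varphi)=\min\{p_R(\varphi),q_L(\varphi)\}$. **Expansive directions.** Let $r\in\mathbb R$. A $\varphi$-orbit is a sequence $(x_i)_{i\in\mathbb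 Z}$ in $X$ with $\varphi(x_i)=x_{i+1}$ for all $i$. For onto $\varphi$: $r$ is a left (resp. right) $\sigma$-expansive direction for $\varphi$ if there is $\delta>0$ such that for any $\varphi$-orbits $(x_i),(y_i)$, if $d_X(\sigma^j(x_i),\sigma^j(y_i))\le\delta$ for all $(i,j)\in\mathbb Z^2$ with $j\le ri$ (resp. $j\ge ri$), then $(x_i)_{i\in\mathbb Z}=(y_i)_{i\in\mathbb Z}$; $r$ is a left (resp. right) $\sigma$-expansive direction on the upper side if the same holds with the inequality assumed only for $(i,j)\in\mathbb Z^2$ with $i\le0$ and $j\le ri$ (resp. $i\le 0$ and $j\ge ri$); $r$ is an expansive direction if there are $\delta>0,t\ge0$ such that the inequality for all $(i,j)\in\mathbb Z^2$ with $|j-ri|\le t$ implies equality of the orbits. $E_L(\varphi),E_R(\varphi),E(\varphi)\subset\mathbb R$ denote the sets of left $\sigma$-expansive, right $\sigma$-expansive and expansive directions for $\varphi$. For arbitrary $\varphi$: $r$ is a positively left (resp. right) $\sigma$-expansive direction if there is $\delta>0$ such that for $x,y\in X$, $d_X(\sigma^j\varphi^i(x),\sigma^j\varphi^i(y))\le\delta$ for all $(i,j)\in\mathbb Z^2$ with $i\ge0$ and $j\le ri$ (resp. $i\ge 0$ and $j\ge ri$) implies $x=y$; $r$ is a positively expansive direction if there are $\delta>0,t\ge0$ such that the inequality for all $(i,j)\in\mathbb Z^2$ with $i\ge0$, $|j-ri|\le t$ implies $x=y$. *)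

(* Defs.v *)
From HB Require Import structures.
From mathcomp Require Import all_boot all_order all_algebra.
From mathcomp Require Import all_classical all_reals all_analysis.
Set Implicit Arguments.
Unset Strict Implicit.
Unset Printing Implicit Defensive.
Import Order.TTheory GRing.Theory Num.Theory.
Import numFieldNormedType.Exports.
Local Open Scope classical_set_scope.
Local Open Scope ring_scope.

(* A^Z with the product of the discrete topologies. *)
Notation config A := (prod_topology (fun _ : int => discrete_topology A)).

Section Subshifts.
Variable A : finType.
Implicit Types (X : set (config A)) (phi : config A -> config A).

(* The integer power sigma^j of the shift sigma = shift 1. *)
Definition shift (j : int) (a : config A) : config A := fun i => a (i + j).

Definition subshift X : Prop := closed X /\ shift 1 @` X = X.

(* Maps X -> X are represented by total maps on A^Z of which only the
   restriction to X is ever used. *)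
Definition endomorphism X phi : Prop :=
  [/\ set_fun X X phi,
      {within X, continuous phi}
    & forall x, X x -> phi (shift 1 x) = shift 1 (phi x)].

Definition onto X phi : Prop := phi @` X = X.

Definition is_orbit X phi (x : int -> config A) : Prop :=
  (forall i, X (x i)) /\ (forall i, phi (x i) = x (i + 1)).

(* The word a_j a_{j+1} ... a_{j+N}. *)
Definition word (N : nat) (a : config A) (j : int) : N.+1.-tuple A :=
  [tuple (a (j + (k : nat)%:Z) : A) | k < N.+1].

(* A local rule L_{N+1}(X) -> L_1(X) is represented by a total function on
   words; every notion below evaluates it only at words of points of X, and
   [local_rule] forces the values there to lie in L_1(X). *)
Section LocalRules.
Variables (X : set (config A)) (N : nat) (f : N.+1.-tuple A -> A).

Definition local_rule : Prop :=
  forall a, X a -> X (fun j => f (word N a j)).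

Definition left_redundant (I : nat) : Prop :=
  forall a b, X a -> X b -> (forall j : int, 0 <= j -> a j = b j) ->
    f (word N a (- I%:Z)) = f (word N b (- I%:Z)).

Definition right_redundant (I : nat) : Prop :=
  forall a b, X a -> X b -> (forall j : int, j <= 0 -> a j = b j) ->
    f (word N a (I%:Z - N%:Z)) = f (word N b (I%:Z - N%:Z)).

Definition right_mergible (k : nat) : Prop :=
  forall a b, X a -> X b -> (forall j : int, j <= 0 -> a j = b j) ->
    (forall j : int, 1 <= j <= k%:Z + 1 ->
      f (word N a (j - N%:Z)) = f (word N b (j - N%:Z))) ->
    a 1 = b 1.

Definition left_mergible (k : nat) : Prop :=
  forall a b, X a -> X b -> (forall j : int, 0 <= j -> a j = b j) ->
    (forall j : int, 1 <= j <= k%:Z + 1 ->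
      f (word N a (- j)) = f (word N b (- j))) ->
    a (- 1) = b (- 1).

End LocalRules.

Definition is_of_type X phi (m n : nat) (f : (m + n).+1.-tuple A -> A) : Prop :=
  local_rule X f /\
  forall a, X a -> phi a = fun j => f (word (m + n) a (j - m%:Z)).

Variable R : realType.

Definition strictly_redundant (red : nat -> Prop) (I : \bar R) : Prop :=
  (exists2 i : nat, I = i%:R%:E & red i /\ ~ red i.+1) \/
  (I = +oo%E /\ forall i, red i).

Definition strictly_mergible (mrg : nat -> Prop) (k : \bar R) : Prop :=
  (exists2 i : nat, k = i%:R%:E & mrg i /\ forall j, (j < i)%N -> ~ mrg j) \/
  (k = +oo%E /\ forall i, ~ mrg i).

(* The values below do not depend on m, n, f: for an endomorphism, each of the
   sets is a singleton (for QR and QL, when X is infinite). *)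
Definition PL X phi : \bar R :=
  xget 0%E [set v | exists m n (f : (m + n).+1.-tuple A -> A) I,
    [/\ is_of_type X phi f, strictly_redundant (left_redundant X f) I
      & v = (I - m%:R%:E)%E]].

Definition PR X phi : \bar R :=
  xget 0%E [set v | exists m n (f : (m + n).+1.-tuple A -> A) J,
    [/\ is_of_type X phi f, strictly_redundant (right_redundant X f) J
      & v = (J - n%:R%:E)%E]].

Definition QR X phi : \bar R :=
  if `[< finite_set X >] then +oo%E else
  xget 0%E [set v | exists m n (f : (m + n).+1.-tuple A -> A) k,
    [/\ is_of_type X phi f, strictly_mergible (right_mergible X f) k
      & v = (n%:R%:E - k)%E]].

Definition QL X phi : \bar R :=
  if `[< finite_set X >] then +oo%E else
  xget 0%E [set v | exists m n (f : (m + n).+1.-tuple A -> A) l,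
    [/\ is_of_type X phi f, strictly_mergible (left_mergible X f) l
      & v = (m%:R%:E - l)%E]].

(* lim_(s -> oo) D (phi^s) / s *)
Definition growth (D : (config A -> config A) -> \bar R) phi : \bar R :=
  lim ((fun s : nat => (D (iter s phi) * (s%:R^-1)%:E)%E) @ \oo).

Definition pL X phi : \bar R := growth (PL X) phi.
Definition pR X phi : \bar R := growth (PR X) phi.
Definition qR X phi : \bar R := growth (QR X) phi.
Definition qL X phi : \bar R := growth (QL X) phi.

Definition cR X phi : \bar R := Order.max (- pL X phi)%E (- qR X phi)%E.
Definition cL X phi : \bar R := Order.min (pR X phi) (qL X phi).

(* d restricts to a metric on X inducing the topology of X. *)
Definition compatible_metric X (d : config A -> config A -> R) : Prop :=
  [/\ forall x y, X x -> X y -> 0 <= d x y,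
      forall x y, X x -> X y -> (d x y = 0 <-> x = y),
      forall x y, X x -> X y -> d x y = d y x,
      forall x y z, X x -> X y -> X z -> d x z <= d x y + d y z
    & forall x, X x ->
        within X (nbhs x) =
        filter_from [set e : R | 0 < e] (fun e => X `&` [set y | d x y < e])].

Section Directions.
Variables (X : set (config A)) (phi : config A -> config A).
Variable d : config A -> config A -> R.

(* S is the set of (i, j) at which two orbits are compared. *)
Definition orbits_separated_on (S : int -> int -> Prop) (delta : R) : Prop :=
  forall x y : int -> config A, is_orbit X phi x -> is_orbit X phi y ->
    (forall i j : int, S i j -> d (shift j (x i)) (shift j (y i)) <= delta) ->
    x = y.

(* Here only the (i, j) with i >= 0 are used, i being a natural number. *)
Definition points_separated_on (S : nat -> int -> Prop) (delta : R) : Prop :=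
  forall x y, X x -> X y ->
    (forall (i : nat) (j : int), S i j ->
      d (shift j (iter i phi x)) (shift j (iter i phi y)) <= delta) ->
    x = y.

Definition left_expansive : set R := [set r | exists2 delta, 0 < delta &
  orbits_separated_on (fun i j => j%:~R <= r * i%:~R) delta].

Definition right_expansive : set R := [set r | exists2 delta, 0 < delta &
  orbits_separated_on (fun i j => r * i%:~R <= j%:~R) delta].

Definition left_expansive_upper : set R := [set r | exists2 delta, 0 < delta &
  orbits_separated_on (fun i j => i <= 0 /\ j%:~R <= r * i%:~R) delta].

Definition right_expansive_upper : set R := [set r | exists2 delta, 0 < delta &
  orbits_separated_on (fun i j => i <= 0 /\ r * i%:~R <= j%:~R) delta].

Definition expansive : set R := [set r | exists delta t, [/\ 0 < delta, 0 <= t &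
  orbits_separated_on (fun i j => `|j%:~R - r * i%:~R| <= t) delta]].

Definition pos_left_expansive : set R := [set r | exists2 delta, 0 < delta &
  points_separated_on (fun i j => j%:~R <= r * i%:R) delta].

Definition pos_right_expansive : set R := [set r | exists2 delta, 0 < delta &
  points_separated_on (fun i j => r * i%:R <= j%:~R) delta].

Definition pos_expansive : set R :=
  [set r | exists delta t, [/\ 0 < delta, 0 <= t &
    points_separated_on (fun i j => `|j%:~R - r * i%:R| <= t) delta]].

End Directions.

(* The real interval (a, b) with extended real ends; empty when b <= a. *)
Definition interv (a b : \bar R) : set R :=
  [set r | (a < r%:E)%E /\ (r%:E < b)%E].

Definition is_component (E C : set R) : Prop :=
  exists2 x, E x & C = connected_component E x.

(* C is the only component of E that is not bounded above (resp. below). *)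
Definition is_right_unbounded_component (E C : set R) : Prop :=
  [set D | is_component E D /\ ~ has_ubound D] = [set C].

Definition is_left_unbounded_component (E C : set R) : Prop :=
  [set D | is_component E D /\ ~ has_lbound D] = [set C].

End Subshifts.

Arguments PL {A R}.
Arguments PR {A R}.
Arguments QR {A R}.
Arguments QL {A R}.
Arguments pL {A} R.
Arguments pR {A} R.
Arguments qR {A} R.
Arguments qL {A} R.
Arguments cR {A} R.
Arguments cL {A} R.

(* Main.v *)
Require Import Defs.
From HB Require Import structures.
From mathcomp Require Import all_boot all_order all_algebra.
From mathcomp Require Import all_classical all_reals all_analysis.
From mathcomp Require Import zify lra.

(** The theorem is proved by reducing every notion to agreement of
    configurations at coordinates, and by finding what happens exactly on the
    critical slopes.

    By compactness of [X], closeness for a compatible metric is agreement on a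
    central window, and a half-plane of indices may be translated along [j].
    Hence [r] is, for instance, a right expansive direction if and only if two
    orbits agreeing at all [(i, j)] with [j >= r i] are equal ([right_sep]):
    constants and metric disappear ([right_expansiveE] and its companions).

    An endomorphism reaches [p] cells to the left if agreement on [[0, oo)]
    gives agreement of the images on [[-p, oo)]; [PL] is the supremum of such
    [p] ([PLE]). It recovers [q] cells to the right if, for left asymptotic
    points, agreement of the images up to [n - q] gives agreement up to [n];
    [QR] is the supremum of such [q], also when [X] is finite ([QRE]). Both
    notions add up under composition, so by Fekete's lemma ([cvg_degree_slope])
    [pL] and [qR] are suprema of slopes [p / s] reached or recovered by
    [iter s phi]. Repeating one reach of slope larger than [- r] spreads
    agreement from a half-line in the far past over the whole line
    ([left_reach_expansive]); repeating a recovery does the same from the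
    future ([right_recovery_expansive]). This gives expansiveness for
    [r > - pL], resp. [r > - qR].

    Conversely let [pL = l] be real. For each [s] some pair [a, b] violates the
    reach [floor (l s) + 1] of [iter s phi]. Let [c i] be the last coordinate
    where [iter i phi a] and [iter i phi b] differ. Then [g i = c i + l i]
    increases by at most [eps k + C] over [k] steps, and it does not end below
    its initial value. Maximizing [g] with a small penalty for the distance to
    the middle of the run ([near_peak]) yields a time [t], far from both ends,
    with [g i <= g t + 1] for all [i] in a long window around [t]. Centring the
    run at [(t, c t)] and letting the window grow, compactness produces two
    different orbits agreeing to the right of a line of slope [- l]
    ([critical_left_reach]). The critical slope of [qR] is treated by first
    differences and time reversal ([critical_right_recovery]), and the case
    [qR = -oo] by the failure of right closing. As the upper and the positive
    notions are monotone in [r], the sets of such directions are exactly the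
    stated rays; as the critical slope is not even in [E_R], resp. [E_L], these
    rays are components there.

    The statements for the other side follow by the reflection of
    coordinates. Finally [E] is the intersection of [E_L] and [E_R]
    ([strip_sepP]): by compactness right expansiveness is a finite statement,
    which widens a strip of agreement to the left, step by step, up to a
    half-plane. *)

Set Implicit Arguments.
Unset Strict Implicit.
Unset Printing Implicit Defensive.
Import Order.TTheory GRing.Theory Num.Theory.
Import numFieldNormedType.Exports.
Local Open Scope classical_set_scope.
Local Open Scope ring_scope.

(* The shift of configurations, hidden by another notion of the same name. *)
Local Notation shift := Defs.shift.

(** * Superadditive families of integers *)

Section Fekete.
Context {R : realType} (P : nat -> int -> Prop).
Hypothesis P0 : P 0 0.
Hypothesis PD : forall s t p q, P s p -> P t q -> P (s + t)%N (p + q).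

Definition slope_sup : \bar R :=
  ereal_sup [set c | exists s p, [/\ (0 < s)%N, P s p & c = (p%:~R / s%:R)%:E]].

Definition degree (Q : int -> Prop) : \bar R :=
  ereal_sup [set p%:~R%:E | p in Q].

Lemma slope_supP (c : R) : (c%:E < slope_sup)%E ->
  exists s p, [/\ (0 < s)%N, P s p & c * s%:R < p%:~R].
Proof.
move=> /ereal_sup_gt [_ [s [p [s0 Psp ->]]]]; rewrite lte_fin => h.
by exists s, p; split => //; rewrite -ltr_pdivlMr ?ltr0n.
Qed.

Lemma le_slope_sup s p : (0 < s)%N -> P s p ->
  ((p%:~R / s%:R)%:E <= slope_sup)%E.
Proof. by move=> s0 Psp; apply: ereal_sup_ubound; exists s, p. Qed.

Lemma slope_sup_bound (l : R) s p : (slope_sup <= l%:E)%E -> (0 < s)%N ->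
  P s p -> p%:~R <= l * s%:R.
Proof.
move=> hl s0 Psp; rewrite -ler_pdivrMr ?ltr0n // -lee_fin.
exact: le_trans (le_slope_sup s0 Psp) hl.
Qed.

Lemma superadditive_mul s p q : P s p -> P (q * s)%N (p *+ q).
Proof.
move=> Psp; elim: q => [|q IH]; first by rewrite mul0n mulr0n.
by rewrite mulSn mulrS; apply: PD.
Qed.

(** A slope below the supremum is attained along all integers up to a bounded
    error: write [k = q s + t] for one good [s] and fill the remainder with
    copies of [p1]. *)
Lemma slope_linear_bound p1 (c : R) : P 1%N p1 -> (c%:E < slope_sup)%E ->
  exists C : R, forall k, exists2 p, P k p & c * k%:R - C <= p%:~R.
Proof.
move=> P1 /slope_supP [s [p [s0 Psp cp]]].
(* The remainder [t < s] costs at most [(`|c| + `|p1|) t]. *)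
exists ((`|c| + `|p1%:~R|) * s%:R) => k.
exists (p *+ (k %/ s)%N + p1 *+ (k %% s)%N).
  rewrite {1}(divn_eq k s); apply: PD; first exact: superadditive_mul.
  by rewrite -[X in P X](muln1 (k %% s)%N); apply: superadditive_mul.
have mulE (a : int) n : (a *+ n)%:~R = a%:~R * n%:R :> R.
  by rewrite mulr_natr rmorphMn.
rewrite {1}(divn_eq k s) natrD natrM intrD !mulE.
set q := (k %/ s)%N%:R; set t := (k %% s)%N%:R.
have q0 : (0 : R) <= q by rewrite ler0n.
have t0 : (0 : R) <= t by rewrite ler0n.
have ts : t <= s%:R :> R by rewrite ler_nat ltnW // ltn_mod.
have h1 := ler_wpM2r q0 (ltW cp).
have := ler_norm c; have := ler_norm (- p1%:~R : R); rewrite normrN => h3 h4.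
have h5 := ler_wpM2r t0 h3; have h6 := ler_wpM2r t0 h4.
have h7 : (`|c| + `|p1%:~R|) * t <= (`|c| + `|p1%:~R|) * s%:R.
  by apply: ler_wpM2l => //; apply: addr_ge0.
by move: h1 h5 h6 h7; lra.
Qed.

(** Excludes for instance families inhabited at even indices only, for which
    the degree divided by the index oscillates between real values and -oo. *)
Hypothesis P1 : forall s p, (0 < s)%N -> P s p -> exists p1, P 1%N p1.

Lemma degree_le_slope s : (0 < s)%N ->
  (degree (P s) * (s%:R^-1)%:E <= slope_sup)%E.
Proof.
move=> s0; rewrite lee_pdivrMr ?ltr0n //.
apply: ge_ereal_sup => _ [p Psp <-].
rewrite -lee_pdivrMr ?ltr0n //; exact: le_slope_sup.
Qed.

Lemma near_le_degree (c : R) : (c%:E < slope_sup)%E ->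
  \forall s \near \oo, (c%:E <= degree (P s) * (s%:R^-1)%:E)%E.
Proof.
move=> clt.
(* An intermediate slope absorbs the bounded error of [slope_linear_bound]. *)
have [c' cc' c'lt] : exists2 c' : R, c < c' & (c'%:E < slope_sup)%E.
  case: slope_sup clt => [l||] //.
    rewrite lte_fin => cl; exists ((c + l) / 2); rewrite ?lte_fin; lra.
  by move=> _; exists (c + 1); rewrite ?ltry //; lra.
have [s0 [p0 [s00 Ps0 _]]] := slope_supP clt.
have [p1 Pp1] := P1 s00 Ps0.
have [C hC] := slope_linear_bound Pp1 c'lt.
near=> s.
have s1 : (0 < s)%N by near: s; exact: nbhs_infty_gt.
have sR : (0 : R) < s%:R by rewrite ltr0n.
have [p Psp hp] := hC s.
rewrite lee_pdivlMr //; apply: (@le_trans _ _ p%:~R%:E); last first.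
  by apply: ereal_sup_ubound; exists p.
rewrite -EFinM lee_fin; apply: le_trans hp.
have : C / (c' - c) <= s%:R by near: s; exact: nbhs_infty_ger.
by rewrite ler_pdivrMr ?subr_gt0 //; lra.
Unshelve. all: by end_near. Qed.

(** Fekete's lemma. When no [P s] with [0 < s] is inhabited both sides are -oo. *)
Lemma cvg_degree_slope :
  (degree (P s) * (s%:R^-1)%:E)%E @[s --> \oo] --> slope_sup.
Proof.
have [y|l|ly] : [\/ slope_sup = +oo%E, exists l, slope_sup = l%:E | slope_sup = -oo%E].
  by case E : slope_sup => [l||]; [apply: Or32; exists l | apply: Or31 | apply: Or33].
- rewrite y; apply/cvgeyPge => c; apply: near_le_degree; by rewrite y ltry.
- case: l => l hl.
  have up : \forall s \near \oo, (degree (P s) * (s%:R^-1)%:E <= l%:E)%E.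
    by near=> s; rewrite -hl; apply: degree_le_slope; near: s; exact: nbhs_infty_gt.
  have lo (e : R) : 0 < e ->
      \forall s \near \oo, ((l - e)%:E <= degree (P s) * (s%:R^-1)%:E)%E.
    by move=> e0; apply: near_le_degree; rewrite hl lte_fin; lra.
  have fn : \forall s \near \oo, (degree (P s) * (s%:R^-1)%:E)%E \is a fin_num.
    have lo1 := lo 1 ltr01.
    near=> s; rewrite fin_numE; apply/andP; split; apply/eqP => E.
      have : ((l - 1)%:E <= degree (P s) * (s%:R^-1)%:E)%E by near: s.
      by rewrite E leeNy_eq => /eqP.
    have : (degree (P s) * (s%:R^-1)%:E <= l%:E)%E by near: s.
    by rewrite E leye_eq => /eqP.
  rewrite hl; apply/fine_cvgP; split => //; apply/cvgrPdist_le => e e0.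
  have loe := lo e e0.
  near=> s.
  have fs : (degree (P s) * (s%:R^-1)%:E)%E \is a fin_num by near: s.
  have : ((l - e)%:E <= degree (P s) * (s%:R^-1)%:E)%E by near: s.
  have : (degree (P s) * (s%:R^-1)%:E <= l%:E)%E by near: s.
  rewrite -(fineK fs) !lee_fin /= => h1 h2; rewrite ler_norml; apply/andP; lra.
- rewrite ly; apply: cvg_near_cst; near=> s.
  have s1 : (0 < s)%N by near: s; exact: nbhs_infty_gt.
  by have := degree_le_slope s1; rewrite ly leeNy_eq => /eqP.
Unshelve. all: by end_near. Qed.

End Fekete.

(** * Near-maxima inside a long run *)

Section Peak.
Context {R : realType}.

(** Maximize [g i - |i - u| / T] over the run. The penalty varies by at most 1
    over a window of radius [T]. It also keeps the maximum away from the ends: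
    there it exceeds [(u - T) / T], whereas no value of [g] exceeds [g u] by
    more than [3 eps u + 2 C] with [eps = 1 / (6 T)], which is less once [u] is
    large. *)
Lemma near_peak (T : nat) (C : R) : (0 < T)%N -> exists2 u : nat,
  (0 < u)%N & forall g : nat -> R,
  (forall i k, (i + k <= 2 * u)%N -> g (i + k)%N <= g i + (6 * T%:R)^-1 * k%:R + C) ->
  g 0%N <= g (2 * u)%N ->
  exists t, [/\ (T <= t)%N, (t + T <= 2 * u)%N &
    forall i, (t <= i + T)%N -> (i <= t + T)%N -> g i <= g t + 1].
Proof.
move=> T0; have TR : (0 : R) < T%:R by rewrite ltr0n.
have [u hu] := filter_ex (nbhs_infty_gtr (T%:R * (2 + 4 * `|C|) : R)).
have u0 : (0 : R) < u%:R.
  have C0 : 0 <= 2 + 4 * `|C| by have := normr_ge0 C; lra.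
  exact: le_lt_trans (mulr_ge0 (ltW TR) C0) hu.
exists u; first by rewrite -(ltr_nat R).
move=> g hg h0.
(* The distance to the middle [u] of the run, to be penalized. *)
pose dev (i : nat) : R := `|i%:R - u%:R|.
pose G (i : 'I_(2 * u).+1) := g i - T%:R^-1 * dev i.
case: (@arg_maxP _ _ _ (ord0 : 'I_(2 * u).+1) xpredT G isT) => t _ tmax.
have tu : (t <= 2 * u)%N by rewrite -ltnS.
have uu : (u < (2 * u).+1)%N by lia.
have devT : dev t <= u%:R - T%:R.
  have := tmax (Ordinal uu) isT; rewrite /G /= {1}/dev subrr normr0 mulr0 subr0.
  have := hg 0%N t; rewrite add0n => /(_ tu) h1.
  have := hg u u; rewrite addnn -mul2n => /(_ (leqnn _)) h2 h3.
  have t2 : t%:R <= 2 * u%:R :> R by rewrite -natrM ler_nat.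
  have e6 : (6 * T%:R)^-1 = 6^-1 * T%:R^-1 :> R by rewrite invfM.
  rewrite e6 in h1 h2; move: h1 h2 h3; set e := T%:R^-1 => h1 h2 h3.
  have e0 : 0 < e by rewrite invr_gt0.
  have eT : T%:R * e = 1 by rewrite mulfV ?gt_eqF.
  have h4 : e * dev t <= 2^-1 * e * u%:R + 2 * C.
    have := ler_wpM2l (ltW e0) t2; lra.
  have := ler_wpM2l (ltW TR) h4.
  rewrite mulrA eT mul1r mulrDr => h5.
  have h6 : T%:R * (2^-1 * e * u%:R) = 2^-1 * u%:R.
    by rewrite -mulrA mulrCA (mulrA T%:R) eT mul1r.
  have := ler_wpM2l (ltW TR) (ler_norm C).
  by move: h5; rewrite h6; move: hu; lra.
have [tT Tt] : (T <= t)%N /\ (t + T <= 2 * u)%N.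
  move: devT; rewrite /dev ler_norml => /andP[h1 h2].
  by split; rewrite -(ler_nat R) ?natrD ?natrM; lra.
exists t; split => // i ti it.
have i2 : (i < (2 * u).+1)%N by lia.
have := tmax (Ordinal i2) isT; rewrite /G /= => h.
have h1 : dev i <= dev t + T%:R.
  apply: (@le_trans _ _ (dev t + `|i%:R - t%:R|)).
    apply: le_trans (ler_normD _ _).
    by rewrite (_ : _ - _ + _ = i%:R - u%:R) //; lra.
  rewrite lerD2l ler_norml.
  move: ti it; rewrite -(ler_nat R) -(ler_nat R i) !natrD => ti it; apply/andP; lra.
have e0 : (0 : R) < T%:R^-1 by rewrite invr_gt0.
have := ler_wpM2l (ltW e0) h1; rewrite mulrDr mulVf ?gt_eqF //; lra.
Qed.
End Peak.

(** * Configurations: limits and compactness *)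

Section Limits.
Context (A : finType).
Implicit Types (X : set (config A)) (phi : config A -> config A).

Lemma ultra_const (U : set_system nat) (u : nat -> A) : UltraFilter U ->
  exists a, \forall n \near U, u n = a.
Proof.
move=> hU; apply: contrapT => /forallNP h.
have : \forall n \near U, forall a, u n <> a.
  apply: filter_forall => a.
  by have [|//] := in_ultra_setVsetC [set n | u n = a] hU => /h.
by case/filter_ex => n /(_ (u n)).
Qed.

(** All compactness arguments go through limits along one ultrafilter, since it
    makes every coordinate of every family converge at the same time,
    whatever the index set [I]. *)
Lemma pointwise_cluster (I : Type) (u : nat -> I -> A) :
  exists (U : set_system nat) (v : I -> A),
    [/\ ProperFilter U, \oo `<=` U & forall i, \forall n \near U, u n i = v i].
Proof.
have [U [hU sU]] := ultraFilterLemma eventually_filter.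
have /choice [v hv] i := ultra_const (u ^~ i) hU.
by exists U, v; split => //; exact: ultra_proper.
Qed.

Lemma near_window (U : set_system nat) {FU : Filter U} (P : nat -> int -> Prop) :
  (forall j, \forall n \near U, P n j) ->
  forall w : nat, \forall n \near U, forall j : int, `|j| <= w%:Z -> P n j.
Proof.
move=> h w; pose dec (k : 'I_(2 * w).+1) : int := (k : nat)%:Z - w%:Z.
have : \forall n \near U, forall k, P n (dec k) by apply: filter_forall => k.
apply: filterS => n hn j hj.
have kw : (absz (j + w%:Z)%R < (2 * w).+1)%N by lia.
by have := hn (Ordinal kw); rewrite /dec /= (_ : _ - _ = j) //; lia.
Qed.

(** The combinatorial content of an endomorphism of a subshift: closedness is
    tested on windows, and continuity is a radius (Curtis, Hedlund, Lyndon). *)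
Record cellular X phi : Prop := Cellular {
  cel_closed : forall v : config A,
    (forall w : nat, exists2 x, X x & forall j : int, `|j| <= w%:Z -> x j = v j) ->
    X v;
  cel_shift : forall k x, X x -> X (shift k x);
  cel_map : forall x, X x -> X (phi x);
  cel_comm : forall k x, X x -> phi (shift k x) = shift k (phi x);
  cel_radius : exists m : nat, forall x y, X x -> X y ->
    (forall j : int, `|j| <= m%:Z -> x j = y j) -> phi x 0 = phi y 0 }.

Lemma cel_local X phi : cellular X phi ->
  exists m : nat, forall x y c, X x -> X y ->
    (forall j : int, `|j - c| <= m%:Z -> x j = y j) -> phi x c = phi y c.
Proof.
move=> h; have [m hm] := cel_radius h; exists m => x y c Xx Xy e.
have := hm _ _ (cel_shift h c Xx) (cel_shift h c Xy).
rewrite !(cel_comm h) // /shift add0r; apply=> j hj.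
by apply: e; rewrite addrK.
Qed.

Lemma cellular_iter X phi s : cellular X phi -> cellular X (iter s phi).
Proof.
move=> h; elim: s => [|s IH] /=.
  split => //; [exact: cel_closed h|exact: cel_shift h|].
  by exists 0%N => x y _ _; apply.
split; [exact: cel_closed h|exact: cel_shift h|..].
- by move=> x Xx; apply/(cel_map h)/(cel_map IH).
- by move=> k x Xx /=; rewrite (cel_comm IH) // (cel_comm h) //; apply: (cel_map IH).
- have [m hm] := cel_radius h; have [n hn] := cel_local IH.
  exists (m + n)%N => x y Xx Xy e; apply: hm; try exact: (cel_map IH).
  move=> j hj; apply: hn => // i hi; apply: e; lia.
Qed.

Lemma cel_lim X phi (U : set_system nat) (x : nat -> config A) (v : config A) :
  cellular X phi -> ProperFilter U -> (forall n, X (x n)) ->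
  (forall j, \forall n \near U, x n j = v j) ->
  X v /\ forall j, \forall n \near U, phi (x n) j = phi v j.
Proof.
move=> h FU Xx hx.
have win (w : nat) :
    \forall n \near U, forall j : int, `|j| <= w%:Z -> x n j = v j.
  exact: near_window hx w.
have Xv : X v.
  by apply: (cel_closed h) => w; have [n hn] := filter_ex (win w); exists (x n).
split => // j; have [m hm] := cel_local h.
apply: filterS (win (m + `|j|)%N) => n hn.
by apply: hm => // i hi; apply: hn; lia.
Qed.

(** Pieces of orbits of growing length, distinguished at the origin, have two
    genuine distinct orbits as a limit. A point need not have a preimage;
    the limit has a past because the pieces have one. *)
Lemma orbit_limit X phi (S : int -> int -> Prop) : cellular X phi ->
  (forall T : nat, exists x y : int -> config A,
     [/\ forall i, X (x i) /\ X (y i),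
         forall i : int, `|i| <= T%:Z ->
           phi (x i) = x (i + 1) /\ phi (y i) = y (i + 1),
         forall i j : int, `|i| <= T%:Z -> `|j| <= T%:Z -> S i j ->
           x i j = y i j
       & x 0 0 <> y 0 0]) ->
  exists x y, [/\ is_orbit X phi x, is_orbit X phi y,
    forall i j, S i j -> x i j = y i j & x 0 0 <> y 0 0].
Proof.
move=> h hT.
have /choice [x /choice [y hxy]] := hT.
pose u T (p : bool * (int * int)) : A :=
  if p.1 then x T p.2.1 p.2.2 else y T p.2.1 p.2.2.
have [U [v [FU oU hv]]] := pointwise_cluster u.
have far (i : int) : \forall T \near U, `|i| <= T%:Z.
  apply: oU; near=> T.
  have : (`|i|%N <= T)%N by near: T; exact: nbhs_infty_ge.
  lia.
have orb (b : bool) (z : nat -> int -> config A) :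
    (forall T i, X (z T i)) ->
    (forall T (i : int), `|i| <= T%:Z -> phi (z T i) = z T (i + 1)) ->
    (forall i j, \forall T \near U, z T i j = v (b, (i, j))) ->
    is_orbit X phi (fun i j => v (b, (i, j))).
  move=> Xz zstep zv; split => i.
    exact: (cel_lim h FU (fun T => Xz T i) (zv i)).1.
  have [_ lim] := cel_lim h FU (fun T => Xz T i) (zv i).
  apply/funext => j.
  have [T [[e1 e2] e3]] := filter_ex (filterI (filterI (lim j) (zv (i + 1) j)) (far i)).
  by rewrite -e2 -e1 zstep.
exists (fun i j => v (true, (i, j))), (fun i j => v (false, (i, j))); split.
- apply: (orb true x) => [T i|T i hi|i j]; last exact: (hv (true, (i, j))).
    by have [hX _ _ _] := hxy T; have [] := hX i.
  by have [_ hs _ _] := hxy T; have [] := hs i hi.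
- apply: (orb false y) => [T i|T i hi|i j]; last exact: (hv (false, (i, j))).
    by have [hX _ _ _] := hxy T; have [] := hX i.
  by have [_ hs _ _] := hxy T; have [] := hs i hi.
- move=> i j Sij.
  have [T [[e1 e2] [e3 e4]]] := filter_ex (filterI
    (filterI (hv (true, (i, j))) (hv (false, (i, j)))) (filterI (far i) (far j))).
  by rewrite -e1 -e2 /u /=; have [_ _ hS _] := hxy T; apply: hS.
- have [T [e1 e2]] := filter_ex (filterI (hv (true, (0, 0))) (hv (false, (0, 0)))).
  by rewrite -e1 -e2 /u /=; have [] := hxy T.
Unshelve. all: by end_near. Qed.

Lemma point_limit X phi (S : nat -> int -> Prop) : cellular X phi ->
  (forall T : nat, exists x y : config A,
     [/\ X x, X y,
         forall (i : nat) (j : int), (i <= T)%N -> `|j| <= T%:Z -> S i j ->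
           iter i phi x j = iter i phi y j
       & x 0 <> y 0]) ->
  exists x y, [/\ X x, X y,
    forall i j, S i j -> iter i phi x j = iter i phi y j & x 0 <> y 0].
Proof.
move=> h hT.
have /choice [x /choice [y hxy]] := hT.
pose u T (p : bool * int) : A := if p.1 then x T p.2 else y T p.2.
have [U [v [FU oU hv]]] := pointwise_cluster u.
have Xx T : X (x T) by have [] := hxy T.
have Xy T : X (y T) by have [] := hxy T.
have hx (j : int) : \forall T \near U, x T j = v (true, j) by exact: (hv (true, j)).
have hy (j : int) : \forall T \near U, y T j = v (false, j) by exact: (hv (false, j)).
exists (fun j => v (true, j)), (fun j => v (false, j)); split.
- exact: (cel_lim h FU Xx hx).1.
- exact: (cel_lim h FU Xy hy).1.
- move=> i j Sij; have hi := cellular_iter i h.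
  have [_ limx] := cel_lim hi FU Xx hx; have [_ limy] := cel_lim hi FU Xy hy.
  have far : \forall T \near U, (i <= T)%N /\ `|j| <= T%:Z.
    apply: oU; near=> T.
    have : (i + `|j|%N <= T)%N by near: T; exact: nbhs_infty_ge.
    lia.
  have [T [[e1 e2] [e3 e4]]] := filter_ex (filterI (filterI (limx j) (limy j)) far).
  by rewrite -e1 -e2; have [_ _ hS _] := hxy T; apply: hS.
- have [T [e1 e2]] := filter_ex (filterI (hx 0) (hy 0)).
  by rewrite -e1 -e2; have [] := hxy T.
Unshelve. all: by end_near. Qed.

End Limits.

(** * Reach and recovery *)

Section Core.
Context (A : finType).
Implicit Types (X : set (config A)) (phi : config A -> config A).

(** The integers [p] that the left redundancy of a local rule measures, freed
    from the choice of the rule. *)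
Definition left_reach X phi (p : int) : Prop := forall x y, X x -> X y ->
  (forall j : int, 0 <= j -> x j = y j) -> phi x (- p) = phi y (- p).

(** The integers [q] that the right mergibility of a local rule measures, freed
    from the choice of the rule; larger [q] is a stronger property. *)
Definition right_recovery X phi (q : int) : Prop := forall x y, X x -> X y ->
  (forall j : int, j <= 0 -> x j = y j) ->
  (forall j : int, j <= 1 - q -> phi x j = phi y j) -> x 1 = y 1.

Lemma left_reach_at X phi p (c : int) x y : cellular X phi -> left_reach X phi p ->
  X x -> X y -> (forall j : int, c <= j -> x j = y j) ->
  forall j : int, c - p <= j -> phi x j = phi y j.
Proof.
move=> h hp Xx Xy e j hj.
have := hp _ _ (cel_shift h (j + p) Xx) (cel_shift h (j + p) Xy).
rewrite !(cel_comm h) // /shift (_ : - p + (j + p) = j); last by lia.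
by apply=> k k0; apply: e; lia.
Qed.

Lemma left_reach_down X phi p q : cellular X phi -> q <= p ->
  left_reach X phi p -> left_reach X phi q.
Proof.
move=> h qp hp x y Xx Xy e; apply: (left_reach_at h hp Xx Xy e); lia.
Qed.

Lemma left_reach0 X phi : left_reach X (iter 0 phi) 0.
Proof. by move=> x y _ _ e /=; apply: e. Qed.

Lemma left_reachD X phi s t p q : cellular X phi ->
  left_reach X (iter s phi) p -> left_reach X (iter t phi) q ->
  left_reach X (iter (s + t) phi) (p + q).
Proof.
move=> h hp hq x y Xx Xy e; rewrite !iterD.
have hs := cellular_iter s h; have ht := cellular_iter t h.
apply: (left_reach_at hs hp (cel_map ht Xx) (cel_map ht Xy)
  (left_reach_at ht hq Xx Xy e)); lia.
Qed.

Lemma left_reach1 X phi : cellular X phi -> exists p, left_reach X phi p.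
Proof.
move=> h; have [m hm] := cel_local h; exists (- m%:Z) => x y Xx Xy e.
by apply: hm => // j hj; apply: e; lia.
Qed.

(** Two points that agree far to the left are recovered one coordinate at a
    time, from left to right. *)
Lemma right_recovery_at X phi q (c n : int) x y :
  cellular X phi -> right_recovery X phi q ->
  X x -> X y -> (forall j : int, j <= c -> x j = y j) ->
  (forall j : int, j <= n - q -> phi x j = phi y j) ->
  forall j : int, j <= n -> x j = y j.
Proof.
move=> h hq Xx Xy e e'.
have step (k : nat) (j : int) : j <= c + k%:Z -> j <= n -> x j = y j.
  elim: k j => [|k IH] j; first by move=> jc _; apply: e; lia.
  move=> jk jn; have [|lt] := leP j (c + k%:Z); first by move=> /IH; apply.
  have := hq _ _ (cel_shift h (j - 1) Xx) (cel_shift h (j - 1) Xy).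
  rewrite !(cel_comm h) // /shift (_ : 1 + (j - 1) = j); last by lia.
  by apply=> i hi; [apply: IH|apply: e']; lia.
move=> j jn; apply: (step (absz (j - c)%R)); lia.
Qed.

Lemma right_recovery_down X phi p q :
  q <= p -> right_recovery X phi p -> right_recovery X phi q.
Proof.
by move=> qp hp x y Xx Xy e e'; apply: hp => // j hj; apply: e'; lia.
Qed.

Lemma right_recovery0 X phi : right_recovery X (iter 0 phi) 0.
Proof. by move=> x y _ _ _ /=; apply; lia. Qed.

Lemma cel_left X phi x y (c : int) : cellular X phi -> X x -> X y ->
  (forall j : int, j <= c -> x j = y j) ->
  exists c', forall j : int, j <= c' -> phi x j = phi y j.
Proof.
move=> h Xx Xy e; have [m hm] := cel_local h.
by exists (c - m%:Z) => j hj; apply: hm => // i hi; apply: e; lia.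
Qed.

Lemma right_recoveryD X phi s t p q : cellular X phi ->
  right_recovery X (iter s phi) p -> right_recovery X (iter t phi) q ->
  right_recovery X (iter (s + t) phi) (p + q).
Proof.
move=> h hp hq x y Xx Xy e e'.
have hs := cellular_iter s h; have ht := cellular_iter t h.
have [c hc] := cel_left ht Xx Xy e.
apply: hq => //; apply: (right_recovery_at hs hp (cel_map ht Xx) (cel_map ht Xy) hc).
by move=> j hj; rewrite -!iterD; apply: e'; lia.
Qed.

(** The qualitative form of recovery: by compactness it is equivalent to a
    recovery by some, possibly very negative, number of cells. *)
Definition right_closing X phi := forall x y, X x -> X y ->
  (forall j : int, j < 0 -> x j = y j) -> phi x = phi y -> x 0 = y 0.

Lemma right_closing_right_recovery X phi : cellular X phi -> right_closing X phi ->
  exists q, right_recovery X phi q.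
Proof.
move=> h cl; apply: contrapT => /forallNP no.
pose S (i : nat) (j : int) := (i = 0%N /\ j < 0) \/ i = 1%N.
have [|x [y [Xx Xy e ne]]] := @point_limit _ _ _ S h.
  move=> T.
  have /existsNP[x /existsNP[y]] := no (- T%:Z).
  move=> /not_implyP[Xx /not_implyP[Xy /not_implyP[e /not_implyP[e' ne]]]].
  exists (shift 1 x), (shift 1 y); split; try exact: (cel_shift h).
    move=> i j _ hj [[-> j0]|->] /=; first by apply: e; lia.
    by rewrite !(cel_comm h) //; apply: e'; lia.
  by rewrite /shift add0r.
apply: ne; apply: cl => // [j j0|]; first by apply: (e 0%N); left.
by apply/funext => j; apply: (e 1%N); right.
Qed.

(** If [phi x = phi y] then all later images agree too, so a recovery by an
    iterate already distinguishes [x] from [y]. *)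
Lemma recovery_right_closing X phi s q : cellular X phi -> (0 < s)%N ->
  right_recovery X (iter s phi) q -> right_closing X phi.
Proof.
move=> h s0 hq x y Xx Xy e e'; have hs := cellular_iter s h.
apply: (right_recovery_at (c := -1) (n := 0) hs hq Xx Xy) => [j j0|j _|]; last by [].
  by apply: e; lia.
by rewrite -(prednK s0) !iterSr e'.
Qed.

Lemma last_diff (x y : config A) (M j0 : int) :
  (forall j, M < j -> x j = y j) -> x j0 <> y j0 ->
  exists c, x c <> y c /\ forall j, c < j -> x j = y j.
Proof.
move=> e ne.
have ex : exists k : nat, `[< x (M - k%:Z) <> y (M - k%:Z) >].
  exists (absz (M - j0)%R); apply/asboolP.
  have : j0 <= M by rewrite leNgt; apply/negP => /e.
  move=> jM; rewrite (_ : M - _ = j0) //; lia.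
case: (ex_minnP ex) => k /asboolP hk kmin.
exists (M - k%:Z); split => // j hj; apply: contrapT => nj.
have jM : j <= M by rewrite leNgt; apply/negP => /e.
have := kmin (absz (M - j)%R); rewrite (_ : M - _ = j); last by lia.
by move=> /(_ (introT (asboolP _) nj)); lia.
Qed.

Lemma first_diff (x y : config A) (M j0 : int) :
  (forall j, j < M -> x j = y j) -> x j0 <> y j0 ->
  exists c, x c <> y c /\ forall j, j < c -> x j = y j.
Proof.
move=> e ne.
have [| |c [nc hc]] := @last_diff (fun j => x (- j)) (fun j => y (- j)) (- M) (- j0).
- by move=> j hj; apply: e; lia.
- by rewrite /= !opprK.
- by exists (- c); split => // j hj; rewrite -[j]opprK; apply: hc; lia.
Qed.

(** Runs are recentred at a time [t] and a place [c] where they still differ;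
    both are free, so that [t] may be far from the start. *)
Lemma run_limit X phi (S : int -> int -> Prop) : cellular X phi ->
  (forall T : nat, exists a b (t : nat) (c : int),
    [/\ X a, X b, (T <= t)%N,
        forall i j : int, `|i| <= T%:Z -> S i j ->
          iter (absz (t%:Z + i)%R) phi a (j + c) = iter (absz (t%:Z + i)%R) phi b (j + c)
      & iter t phi a c <> iter t phi b c]) ->
  exists x y, [/\ is_orbit X phi x, is_orbit X phi y,
    forall i j, S i j -> x i j = y i j & x 0 0 <> y 0 0].
Proof.
move=> h hT; apply: (orbit_limit h) => T.
have [a [b [t [c [Xa Xb Tt e ne]]]]] := hT T.
have Xit n z : X z -> X (iter n phi z) by move=> Xz; apply: (cel_map (cellular_iter n h)).
(* The absolute value only matters before the start of the run, outside the
   window where the pieces have to follow [phi]. *)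
exists (fun i => shift c (iter (absz (t%:Z + i)%R) phi a)).
exists (fun i => shift c (iter (absz (t%:Z + i)%R) phi b)).
split.
- by move=> i; split; apply/(cel_shift h)/Xit.
- move=> i hi; rewrite (_ : absz (t%:Z + (i + 1))%R = (absz (t%:Z + i)%R).+1); last by lia.
  by split; rewrite (cel_comm h) //; apply: Xit.
- by move=> i j hi _ Sij; apply: e.
- by rewrite /shift add0r addr0.
Qed.
End Core.

(** * Critical slopes *)

Section Critical.
Context {R : realType} (A : finType).
Implicit Types (X : set (config A)) (phi : config A -> config A).

Definition left_reach_rate X phi : \bar R :=
  slope_sup (fun s => left_reach X (iter s phi)).

Definition right_recovery_rate X phi : \bar R :=
  slope_sup (fun s => right_recovery X (iter s phi)).

(** At the critical slope the last difference of a well chosen pair stays near a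
    line of slope [- l] for arbitrarily long, hence for ever in the limit. *)
Lemma critical_left_reach X phi (l : R) : cellular X phi ->
  left_reach_rate X phi = l%:E ->
  exists x y, [/\ is_orbit X phi x, is_orbit X phi y,
    forall i j : int, 1 - l * i%:~R < j%:~R -> x i j = y i j & x 0 0 <> y 0 0].
Proof.
move=> h hl.
apply: (run_limit (S := fun i j => 1 - l * i%:~R < j%:~R) h) => T.
have TR : (0 : R) < T.+1%:R by rewrite ltr0n.
pose eps : R := (6 * T.+1%:R)^-1.
have eps0 : 0 < eps by rewrite invr_gt0; apply: mulr_gt0.
have [p1 hp1] := left_reach1 h.
have [C hC] : exists C : R, forall k, exists2 p, left_reach X (iter k phi) p &
    (l - eps) * k%:R - C <= p%:~R.
  apply: (slope_linear_bound (P := fun s => left_reach X (iter s phi))) hp1 _.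
  - exact: left_reach0.
  - by move=> *; apply: left_reachD.
  - by rewrite -/(left_reach_rate X phi) hl lte_fin; lra.
have [u u0 peak] := near_peak C (ltn0Sn T).
set s := (2 * u)%N in peak; have s0 : (0 < s)%N by rewrite /s; lia.
pose p : int := Num.floor (l * s%:R) + 1.
have pls : l * s%:R < p%:~R by rewrite /p floorD1_gt.
have psl : p%:~R <= l * s%:R + 1 by rewrite /p intrD lerD2r floor_le.
have /existsNP[a /existsNP[b]] : ~ left_reach X (iter s phi) p.
  move=> hp; have := @slope_sup_bound R (fun s => left_reach X (iter s phi)) l s p _ s0 hp.
  by rewrite -/(left_reach_rate X phi) hl lexx leNgt pls => /(_ isT).
move=> /not_implyP[Xa /not_implyP[Xb /not_implyP[ab ne]]].
have Xit n z : X z -> X (iter n phi z) by move=> Xz; apply: (cel_map (cellular_iter n h)).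
have /choice [c hc] : forall i, exists c : int, (i <= s)%N ->
    iter i phi a c <> iter i phi b c /\
    forall j, c < j -> iter i phi a j = iter i phi b j.
  move=> i; have [is_|_] := leqP i s; last by exists 0.
  have [M hM] := left_reach1 (cellular_iter i h).
  have [j0 hj0] : exists j, iter i phi a j <> iter i phi b j.
    apply: contrapT => /forallNP e; apply: ne.
    rewrite -(subnK is_) !iterD; congr (iter _ _ _ _).
    by apply/funext => j; apply: contrapT; apply: e.
  have [|c hcc] := last_diff (M := - M) _ hj0; last by exists c.
  move=> j Mj; apply: (left_reach_at (cellular_iter i h) hM Xa Xb ab); lia.
have cstep i k q : (i + k <= s)%N -> left_reach X (iter k phi) q ->
    c (i + k)%N <= c i - q.
  move=> iks hq; have is_ : (i <= s)%N by lia.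
  rewrite leNgt; apply/negP => lt; have [ne' _] := hc _ iks; apply: ne'.
  rewrite addnC !iterD.
  apply: (left_reach_at (c := c i + 1) (cellular_iter k h) hq (Xit i a Xa) (Xit i b Xb)).
    by move=> j hj; apply: (hc i is_).2; lia.
  rewrite addnC; lia.
(* The height of the last difference above the line of slope [- l]. *)
have [|| t [Tt ts tmax]] := peak (fun i => (c i)%:~R + l * i%:R).
- move=> i k iks; have [q hq hqC] := hC k.
  have := cstep i k q iks hq; rewrite -(ler_int R) intrB natrD => h1.
  rewrite -/eps; move: hqC h1; lra.
- have c0 : c 0%N <= -1.
    rewrite leNgt; apply/negP => lt; apply: (hc 0%N isT).1 => /=; apply: ab; lia.
  have cs : - p <= c s.
    rewrite leNgt; apply/negP => lt; apply: ne; apply: (hc s (leqnn _)).2; lia.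
  move: c0 cs; rewrite -!(ler_int R) !intrN => c0 cs; lra.
exists a, b, t, (c t); split => //; first exact: ltnW.
  move=> i j hi hij; have is_ : (absz (t%:Z + i)%R <= s)%N by lia.
  apply: (hc _ is_).2; have := tmax (absz (t%:Z + i)%R).
  have -> : (absz (t%:Z + i)%R)%:R = t%:R + i%:~R :> R.
    by rewrite -[t%:R]/((t%:Z)%:~R) -intrD -[LHS]/((_%:Z)%:~R) gez0_abs //; lia.
  move=> /(_ _ _)H; rewrite -(ltr_int R) intrD.
  have : (t <= absz (t%:Z + i)%R + T.+1)%N by lia.
  have : (absz (t%:Z + i)%R <= t + T.+1)%N by lia.
  by move=> h1 h2; have := H h2 h1; lra.
by apply: (hc t _).1; lia.
Qed.

(** As for the reach, following the first difference of two points that violate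
    the recovery of [floor (l s) + 1] cells. Their images stay different, as
    [phi] is right closing when the rate is real. *)
Lemma critical_right_recovery X phi (l : R) : cellular X phi ->
  right_recovery_rate X phi = l%:E ->
  exists x y, [/\ is_orbit X phi x, is_orbit X phi y,
    forall i j : int, j%:~R < - l * i%:~R - 1 -> x i j = y i j & x 0 0 <> y 0 0].
Proof.
move=> h hl.
apply: (run_limit (S := fun i j => j%:~R < - l * i%:~R - 1) h) => T.
have TR : (0 : R) < T.+1%:R by rewrite ltr0n.
pose eps : R := (6 * T.+1%:R)^-1.
have eps0 : 0 < eps by rewrite invr_gt0; apply: mulr_gt0.
have [q1 hq1] : exists q, right_recovery X phi q.
  have [|s [q [s0 hq _]]] := @slope_supP R (fun s => right_recovery X (iter s phi)) (l - 1).
    by rewrite -/(right_recovery_rate X phi) hl lte_fin; lra.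
  exact: right_closing_right_recovery h (recovery_right_closing h s0 hq).
have [C hC] : exists C : R, forall k, exists2 q, right_recovery X (iter k phi) q &
    (l - eps) * k%:R - C <= q%:~R.
  apply: (slope_linear_bound (P := fun s => right_recovery X (iter s phi))) hq1 _.
  - exact: right_recovery0.
  - by move=> *; apply: right_recoveryD.
  - by rewrite -/(right_recovery_rate X phi) hl lte_fin; lra.
have [u u0 peak] := near_peak C (ltn0Sn T).
set s := (2 * u)%N in peak; have s0 : (0 < s)%N by rewrite /s; lia.
pose p : int := Num.floor (l * s%:R) + 1.
have pls : l * s%:R < p%:~R by rewrite /p floorD1_gt.
have psl : p%:~R <= l * s%:R + 1 by rewrite /p intrD lerD2r floor_le.
have /existsNP[a /existsNP[b]] : ~ right_recovery X (iter s phi) p.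
  move=> hp; have := @slope_sup_bound R (fun s => right_recovery X (iter s phi)) l s p _ s0 hp.
  by rewrite -/(right_recovery_rate X phi) hl lexx leNgt pls => /(_ isT).
move=> /not_implyP[Xa /not_implyP[Xb /not_implyP[ab /not_implyP[abs ne]]]].
have Xit n z : X z -> X (iter n phi z) by move=> Xz; apply: (cel_map (cellular_iter n h)).
have left i : exists M, forall j : int, j <= M -> iter i phi a j = iter i phi b j.
  exact: (cel_left (cellular_iter i h) Xa Xb ab).
have /choice [e he] : forall i, exists e : int,
    iter i phi a e <> iter i phi b e /\
    forall j, j < e -> iter i phi a j = iter i phi b j.
  move=> i; have [q hq _] := hC i; have [M hM] := left i.
  have [j0 hj0] : exists j, iter i phi a j <> iter i phi b j.
    apply: contrapT => /forallNP eq_ab; apply: ne; apply: hq => // j _.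
    by apply: contrapT; apply: eq_ab.
  have [|e he] := first_diff (M := M) _ hj0; last by exists e.
  by move=> j Mj; apply: hM; lia.
have estep i k q : right_recovery X (iter k phi) q -> e (i + k)%N + q <= e i.
  move=> hq; rewrite leNgt; apply/negP => lt; apply: (he i).1.
  have [M hM] := left i.
  apply: (right_recovery_at (n := e (i + k)%N + q - 1) (cellular_iter k h) hq
    (Xit i a Xa) (Xit i b Xb) hM) => [j hj|]; last by lia.
  by rewrite -!iterD addnC; apply: (he _).2; lia.
(* The estimate on [e] runs backwards in time, hence the index [s - i]. *)
have [|| t [Tt ts tmax]] := peak (fun i => - ((e (s - i)%N)%:~R + l * (s - i)%N%:R)).
- move=> i k iks; have [q hq hqC] := hC k.
  have := estep (s - (i + k))%N k q hq.
  have -> : (s - (i + k) + k = s - i)%N by lia.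
  rewrite -(ler_int R) intrD => h1.
  have -> : (s - i)%N%:R = (s - (i + k))%N%:R + k%:R :> R.
    by rewrite -natrD; congr (_%:R); lia.
  rewrite -/eps; move: hqC h1; lra.
- have e0 : e 0%N <= 1.
    rewrite leNgt; apply/negP => lt; apply: ne; exact: (he 0%N).2.
  have es : 2 - p <= e s.
    rewrite leNgt; apply/negP => lt; apply: (he s).1; apply: abs; lia.
  rewrite subn0 subnn; move: e0 es; rewrite -!(ler_int R) intrB => e0 es; lra.
have ets : (s - t <= s)%N by lia.
exists a, b, (s - t)%N, (e (s - t)%N); split => //; first by lia.
  move=> i j hi hij; set t' := absz _.
  apply: (he t').2; have := tmax (s - t')%N.
  have -> : (s - (s - t') = t')%N by rewrite /t'; lia.
  have -> : t'%:R = (s - t)%N%:R + i%:~R :> R.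
    rewrite -[(s - t)%N%:R]/(((s - t)%N%:Z)%:~R) -intrD -[LHS]/((_%:Z)%:~R) gez0_abs //; lia.
  move=> /(_ _ _)H; rewrite -(ltr_int R) intrD.
  have h2 : (t <= s - t' + T.+1)%N by rewrite /t'; lia.
  have h1 : (s - t' <= t + T.+1)%N by rewrite /t'; lia.
  have := H h2 h1; lra.
exact: (he _).1.
Qed.

End Critical.

(** * Half-planes that separate orbits *)

Section Separation.
Context {R : realType} (A : finType).
Implicit Types (X : set (config A)) (phi : config A -> config A) (r : R).

Definition orb_sep X phi (S : int -> int -> Prop) : Prop :=
  forall x y, is_orbit X phi x -> is_orbit X phi y ->
  (forall i j, S i j -> x i j = y i j) -> x = y.

Definition pt_sep X phi (S : nat -> int -> Prop) : Prop :=
  forall x y, X x -> X y ->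
  (forall i j, S i j -> iter i phi x j = iter i phi y j) -> x = y.

Lemma shift_inj (k : int) : injective (@Defs.shift A k).
Proof.
move=> x y e; apply/funext => j; have := congr1 (fun z => z (j - k)) e.
by rewrite /shift subrK.
Qed.

Lemma orbit_iter X phi x i (k : nat) : is_orbit X phi x ->
  iter k phi (x i) = x (i + k%:Z).
Proof.
move=> [_ hx]; elim: k => [|k IH] /=; first by rewrite addr0.
by rewrite IH hx; congr x; lia.
Qed.

Lemma orbit_shift X phi x (a c : int) : cellular X phi -> is_orbit X phi x ->
  is_orbit X phi (fun i => shift c (x (i + a))).
Proof.
move=> h [Xx hx]; split => i; first exact: cel_shift h _ _ (Xx _).
by rewrite (cel_comm h) // hx; congr (shift c (x _)); lia.
Qed.

(** Translating both orbits along [j] translates the set of indices, so the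
    width of a half-plane beyond its boundary line is irrelevant. *)
Lemma orb_sepS X phi (c : int) (S S' : int -> int -> Prop) : cellular X phi ->
  (forall i j, S i j -> S' i (j + c)) -> orb_sep X phi S -> orb_sep X phi S'.
Proof.
move=> h SS' sep x y hx hy e.
have E : (fun i => shift c (x (i + 0))) = (fun i => shift c (y (i + 0))).
  apply: sep; [exact: orbit_shift|exact: orbit_shift|].
  by move=> i j /SS'; rewrite addr0; apply: e.
by apply/funext => i; have := congr1 (fun z => z i) E; rewrite /= addr0 => /shift_inj.
Qed.

Lemma pt_sepS X phi (c : int) (S S' : nat -> int -> Prop) : cellular X phi ->
  (forall i j, S i j -> S' i (j + c)) -> pt_sep X phi S -> pt_sep X phi S'.
Proof.
move=> h SS' sep x y Xx Xy e; apply: (@shift_inj c).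
apply: sep; try exact: cel_shift h _ _ _.
move=> i j /SS' Sij; have hi := cellular_iter i h.
by rewrite !(cel_comm hi) //; apply: e.
Qed.

Definition right_sep X phi r := orb_sep X phi (fun i j => r * i%:~R <= j%:~R).
Definition left_sep X phi r := orb_sep X phi (fun i j => j%:~R <= r * i%:~R).
Definition right_sep_up X phi r :=
  orb_sep X phi (fun i j => i <= 0 /\ r * i%:~R <= j%:~R).
Definition left_sep_up X phi r :=
  orb_sep X phi (fun i j => i <= 0 /\ j%:~R <= r * i%:~R).
Definition strip_sep X phi r :=
  exists2 t : R, 0 <= t & orb_sep X phi (fun i j => `|j%:~R - r * i%:~R| <= t).
Definition pos_left_sep X phi r := pt_sep X phi (fun i j => j%:~R <= r * i%:R).
Definition pos_right_sep X phi r := pt_sep X phi (fun i j => r * i%:R <= j%:~R).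
Definition pos_strip_sep X phi r :=
  exists2 t : R, 0 <= t & pt_sep X phi (fun i j => `|j%:~R - r * i%:R| <= t).

Lemma right_sep_up_le X phi r r' : cellular X phi -> r <= r' ->
  right_sep_up X phi r -> right_sep_up X phi r'.
Proof.
move=> h rr'; apply: (orb_sepS (c := 0) h) => i j [i0 hj]; rewrite addr0; split => //.
apply: le_trans hj; apply: ler_wnM2r => //; by rewrite (ler_int R i 0).
Qed.

Lemma right_sep_up_sep X phi r : cellular X phi ->
  right_sep_up X phi r -> right_sep X phi r.
Proof. by move=> h; apply: (orb_sepS (c := 0) h) => i j [_]; rewrite addr0. Qed.

Lemma pos_left_sep_le X phi r r' : cellular X phi -> r <= r' ->
  pos_left_sep X phi r -> pos_left_sep X phi r'.
Proof.
move=> h rr'; apply: (pt_sepS (c := 0) h) => i j hj; rewrite addr0.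
by apply: le_trans hj _; apply: ler_wpM2r.
Qed.

(** Every point of an orbit starts a forward orbit, whose quadrant is a translate
    of a part of the half-plane. *)
Lemma pos_left_sep_orbit X phi r : cellular X phi ->
  pos_left_sep X phi r -> left_sep X phi r.
Proof.
move=> h sep x y hx hy e; apply/funext => i.
pose c : int := Num.floor (r * i%:~R).
have := pt_sepS (c := c) (S' := fun k j => j%:~R <= r * (i + k%:Z)%:~R) h _ sep.
have cr : c%:~R <= r * i%:~R by exact: floor_le.
apply=> [k j hj||| k j hj]; [| exact: hx.1 | exact: hy.1 |].
  by rewrite !intrD mulrDr addrC; apply: lerD.
by rewrite (orbit_iter _ _ hx) (orbit_iter _ _ hy); apply: e.
Qed.

(** The point at time [i] is the image of the point at time [i - k s], known to
    the right of [r (i - k s)]. Its agreement spreads to the left by [k p],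
    more than [k] times the drift [- r s], hence everywhere as [k] grows. *)
Lemma left_reach_expansive X phi r : cellular X phi ->
  ((- r)%:E < left_reach_rate X phi)%E -> right_sep_up X phi r.
Proof.
move=> h /slope_supP [s [p [s0 hp prs]]] x y hx hy e.
have eq0 i : i <= 0 -> x i = y i.
  move=> i0; apply/funext => j.
  have hk k : left_reach X (iter (k * s) phi) (p *+ k).
    apply: (superadditive_mul (P := fun s => left_reach X (iter s phi))) hp.
      exact: left_reach0.
    by move=> *; apply: left_reachD.
  have [k kbig] := filter_ex (nbhs_infty_gtr ((r * i%:~R + 1 - j%:~R) / (p%:~R + r * s%:R))).
  have d0 : 0 < p%:~R + r * s%:R by lra.
  rewrite ltr_pdivrMr // in kbig.
  pose i' : int := i - (k * s)%N%:Z.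
  have xi : x i = iter (k * s) phi (x i') by rewrite (orbit_iter _ _ hx) /i' subrK.
  have yi : y i = iter (k * s) phi (y i') by rewrite (orbit_iter _ _ hy) /i' subrK.
  rewrite xi yi; pose c : int := Num.floor (r * i'%:~R) + 1.
  have rc : r * i'%:~R < c%:~R by rewrite /c floorD1_gt.
  have cr : c%:~R <= r * i'%:~R + 1 by rewrite /c intrD lerD2r floor_le.
  apply: (left_reach_at (c := c) (cellular_iter _ h) (hk k) (hx.1 _) (hy.1 _)).
    move=> j' cj'; apply: e; split; first by rewrite /i'; lia.
    by rewrite -(ler_int R) in cj'; lra.
  rewrite -(ler_int R) intrB rmorphMn /= -mulr_natr.
  move: cr; rewrite /i' intrB -[(_ %:Z)%:~R]/((k * s)%N%:R) natrM => cr.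
  move: kbig; lra.
apply/funext => i; have [/eq0//|i0] := leP i 0.
have e0 := eq0 0 (lexx 0).
have -> : i = 0 + (absz i)%:Z by lia.
by rewrite -(orbit_iter _ _ hx) -(orbit_iter _ _ hy) e0.
Qed.

(** The image at time [k s] is known up to [r k s], whence the point is known up
    to [k (r s + q)], which is unbounded. *)
Lemma right_recovery_expansive X phi r : cellular X phi ->
  ((- r)%:E < right_recovery_rate X phi)%E -> pos_left_sep X phi r.
Proof.
move=> h /slope_supP [s [q [s0 hq qrs]]] x y Xx Xy e.
have hk k : right_recovery X (iter (k * s) phi) (q *+ k).
  apply: (superadditive_mul (P := fun s => right_recovery X (iter s phi))) hq.
    exact: right_recovery0.
  by move=> *; apply: right_recoveryD.
have d0 : 0 < q%:~R + r * s%:R by lra.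
apply/funext => j.
have [k kbig] := filter_ex (nbhs_infty_gtr (j%:~R / (q%:~R + r * s%:R))).
rewrite ltr_pdivrMr // in kbig.
apply: (right_recovery_at (c := 0) (n := j) (cellular_iter _ h) (hk k)) => // [i i0|i hi].
  by apply: (e 0%N); rewrite mulr0 (ler_int R i 0).
apply: e; move: hi; rewrite -(ler_int R) intrB rmorphMn /= -mulr_natr natrM; lra.
Qed.

Lemma right_sep_critical X phi (l : R) : cellular X phi ->
  left_reach_rate X phi = l%:E -> ~ right_sep X phi (- l).
Proof.
move=> h /(critical_left_reach h) [x [y [hx hy e ne]]].
move=> /(orb_sepS (c := 2) (S' := fun i j => 1 - l * i%:~R < j%:~R) h) sep.
apply: ne; congr (_ 0 0); apply: sep => // i j; rewrite intrD; lra.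
Qed.

Lemma left_sep_critical X phi (l : R) : cellular X phi ->
  right_recovery_rate X phi = l%:E ->
  ~ left_sep X phi (- l) /\ ~ pos_left_sep X phi (- l).
Proof.
move=> h hl; have [x [y [hx hy e ne]]] := critical_right_recovery h hl.
suff nl : ~ left_sep X phi (- l).
  by split => // /(pos_left_sep_orbit h).
(* The critical orbits agree only up to a bounded distance from the line, which
   the shift makes up for. *)
move=> /(orb_sepS (c := -2) (S' := fun i j => j%:~R < - l * i%:~R - 1) h) sep.
apply: ne; congr (_ 0 0); apply: sep => // i j; rewrite intrD; lra.
Qed.

Lemma left_reach_rate_gt X phi : cellular X phi ->
  (-oo < left_reach_rate X phi :> \bar R)%E.
Proof.
move=> h; have [p hp] := left_reach1 h.
have := le_slope_sup (R := R) (P := fun s => left_reach X (iter s phi)) (ltn0Sn 0) hp.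
exact: lt_le_trans (ltNyr _).
Qed.

(** The set is upward closed and the critical slope does not belong to it, even
    for the full half-plane. *)
Lemma right_sep_upP X phi r : cellular X phi ->
  right_sep_up X phi r <-> (- left_reach_rate X phi < r%:E)%E.
Proof.
move=> h; rewrite lteNl -EFinN; split; last exact: left_reach_expansive.
move=> sep; rewrite ltNge; apply/negP => le_r.
have := left_reach_rate_gt h; case E : (left_reach_rate X phi) le_r => [l| |] // lr _.
apply: (right_sep_critical h E); apply: right_sep_up_sep => //.
by apply: right_sep_up_le sep => //; move: lr; rewrite lee_fin; lra.
Qed.

Lemma pos_left_sepP X phi r : cellular X phi ->
  pos_left_sep X phi r <-> (- right_recovery_rate X phi < r%:E)%E.
Proof.
move=> h; rewrite lteNl -EFinN; split; last exact: right_recovery_expansive.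
move=> sep; rewrite ltNge; apply/negP.
case E : (right_recovery_rate X phi) => [l| |] // lr.
  apply: (left_sep_critical h E).2.
  by apply: pos_left_sep_le sep => //; move: lr; rewrite lee_fin; lra.
(* Here no iterate recovers anything, whereas [sep] makes [phi] right closing. *)
have [q hq] : exists q, right_recovery X phi q.
  apply: right_closing_right_recovery => // x y Xx Xy e e'; congr (_ 0).
  apply: (pt_sepS (c := -1) (S' := fun i j => (j < 0) || (0 < i)%N) h _ sep) => //.
    move=> [|i] j; last by rewrite orbT.
    by rewrite mulr0 (ler_int R j 0) orbF; lia.
  case=> [|i] j; first by rewrite orbF => /e.
  by rewrite !iterSr e'.
have := le_slope_sup (R := R) (P := fun s => right_recovery X (iter s phi)) (ltn0Sn 0) hq.
by rewrite -/(right_recovery_rate X phi) E.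
Qed.

End Separation.

(** * Strips and half-planes *)

Section Strip.
Context {R : realType} (A : finType).
Implicit Types (X : set (config A)) (phi : config A -> config A) (r : R).

(** If the finite parts of the half-plane never sufficed, a limit of
    counterexamples would be a pair of orbits violating [right_sep]. *)
Lemma right_sep_finite X phi r : cellular X phi -> right_sep X phi r ->
  exists T : nat, forall x y, is_orbit X phi x -> is_orbit X phi y ->
    (forall i j : int, `|i| <= T%:Z -> `|j| <= T%:Z -> r * i%:~R <= j%:~R ->
      x i j = y i j) ->
    x 0 (- 1) = y 0 (- 1).
Proof.
move=> h sep; apply: contrapT => /forallNP no.
have [|x [y [hx hy e ne]]] :=
    @orbit_limit _ X phi (fun i j => r * i%:~R <= j%:~R - 1) h.
  move=> T; have /existsNP[x /existsNP[y]] := no T.+1.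
  move=> /not_implyP[hx /not_implyP[hy /not_implyP[e ne]]].
  have hx' := orbit_shift 0 (-1) h hx; have hy' := orbit_shift 0 (-1) h hy.
  exists (fun i => shift (-1) (x (i + 0))), (fun i => shift (-1) (y (i + 0))).
  split.
  - by move=> i; split; [apply: hx'.1|apply: hy'.1].
  - by move=> i _; split; [apply: hx'.2|apply: hy'.2].
  - move=> i j hi hj hij; rewrite addr0; apply: e; [lia|lia|by rewrite intrD].
  - by rewrite /shift !addr0 add0r.
apply: ne; congr (_ 0 0); move: sep x y hx hy e => /(orb_sepS (c := 1) h); apply.
by move=> i j; rewrite intrD addrK.
Qed.

Lemma pos_right_sep_finite X phi r : cellular X phi -> pos_right_sep X phi r ->
  exists T : nat, forall x y, X x -> X y ->
    (forall (i : nat) (j : int), (i <= T)%N -> `|j| <= T%:Z ->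
      r * i%:R <= j%:~R -> iter i phi x j = iter i phi y j) ->
    x (- 1) = y (- 1).
Proof.
move=> h sep; apply: contrapT => /forallNP no.
have [|x [y [Xx Xy e ne]]] :=
    @point_limit _ X phi (fun i j => r * i%:R <= j%:~R - 1) h.
  move=> T; have /existsNP[x /existsNP[y]] := no T.+1.
  move=> /not_implyP[Xx /not_implyP[Xy /not_implyP[e ne]]].
  exists (shift (-1) x), (shift (-1) y); split; try exact: cel_shift h _ _ _.
  - move=> i j hi hj hij; have hi' := cellular_iter i h.
    by rewrite !(cel_comm hi') //; apply: e; [lia|lia|rewrite intrD].
  - by rewrite /shift add0r.
apply: ne; congr (_ 0); move: sep x y Xx Xy e => /(pt_sepS (c := 1) h); apply.
by move=> i j; rewrite intrD addrK.
Qed.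

(** Places the finite part of the half-plane needed by [right_sep_finite], once
    moved next to the strip at distance [d], inside a strip of half-width [K]. *)
Lemma strip_width (T : nat) r (i' j' : int) (d K : R) :
  `|i'| <= T%:Z -> `|j'| <= T%:Z -> r * i'%:~R <= j'%:~R ->
  K = T%:R * (1 + `|r|) + 1 -> d < - K ->
  d + 1 + (j'%:~R - r * i'%:~R) <= K.
Proof.
rewrite -!(ler_int R) !intr_norm => hi hj hij -> dK.
have h1 := ler_norm (j'%:~R : R); have h2 := ler_norm (- (r * i'%:~R)).
rewrite normrN normrM in h2.
have h3 := ler_wpM2l (normr_ge0 r) hi.
have h4 : 0 <= T%:R * (1 + `|r|) by apply: mulr_ge0 => //; apply: addr_ge0.
have e : (T%:Z)%:~R = T%:R :> R by [].
rewrite e in hi hj h3; move: h1 h2 h3 h4 hj dK; lra.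
Qed.

(** A strip lies in a translate of each half-plane. Conversely the finite form of
    right expansiveness widens a strip of agreement to the left by one unit,
    again and again; the half-plane so obtained is the one of left
    expansiveness. *)
Lemma strip_sepP X phi r : cellular X phi ->
  strip_sep X phi r <-> left_sep X phi r /\ right_sep X phi r.
Proof.
move=> h; split=> [[t t0 sep]|[lsep rsep]].
  have [c tc] : exists c : int, t <= c%:~R.
    by exists (Num.floor t + 1); apply/ltW/floorD1_gt.
  split; [apply: (orb_sepS (c := - c) h) sep|apply: (orb_sepS (c := c) h) sep];
    move=> i j; rewrite ler_norml intrD ?intrN => /andP[]; lra.
have [T hT] := right_sep_finite h rsep.
pose K : R := T%:R * (1 + `|r|) + 1.
have K0 : 0 <= K by apply: addr_ge0 => //; apply: mulr_ge0 => //; apply: addr_ge0.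
exists K => // x y hx hy e; apply: lsep => // i0 j0 hij0.
have grow (n : nat) i j : - K - n%:R <= j%:~R - r * i%:~R <= K -> x i j = y i j.
  elim: n i j => [|n IH] i j.
    by rewrite subr0 => hij; apply: e; rewrite ler_norml.
  move=> /andP[lo hi]; rewrite -natr1 in lo.
  have [lo'|lo'] := leP (- K - n%:R) (j%:~R - r * i%:~R); first by apply: IH; apply/andP.
  have hx' := orbit_shift i (j + 1) h hx; have hy' := orbit_shift i (j + 1) h hy.
  have := hT _ _ hx' hy'; rewrite /shift add0r (_ : -1 + (j + 1) = j); last by lia.
  apply=> i' j' hi' hj' hij'; apply: IH.
  have n0 : (0 : R) <= n%:R by [].
  have := strip_width (d := j%:~R - r * i%:~R) (K := K) hi' hj' hij' erefl.
  rewrite !intrD mulrDr => H; apply/andP; split; first by lra.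
  have : j%:~R - r * i%:~R < - K by lra.
  move=> /H; lra.
have [n hn] := filter_ex (nbhs_infty_gtr (r * i0%:~R - j0%:~R)).
apply: (grow n); apply/andP; lra.
Qed.

Lemma pos_strip_sepP X phi r : cellular X phi ->
  pos_strip_sep X phi r <-> pos_left_sep X phi r /\ pos_right_sep X phi r.
Proof.
move=> h; split=> [[t t0 sep]|[lsep rsep]].
  have [c tc] : exists c : int, t <= c%:~R.
    by exists (Num.floor t + 1); apply/ltW/floorD1_gt.
  split; [apply: (pt_sepS (c := - c) h) sep|apply: (pt_sepS (c := c) h) sep];
    move=> i j; rewrite ler_norml intrD ?intrN => /andP[]; lra.
have [T hT] := pos_right_sep_finite h rsep.
pose K : R := T%:R * (1 + `|r|) + 1.
have K0 : 0 <= K by apply: addr_ge0 => //; apply: mulr_ge0 => //; apply: addr_ge0.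
exists K => // x y Xx Xy e; apply: lsep => // i0 j0 hij0.
have grow (n : nat) (i : nat) j : - K - n%:R <= j%:~R - r * i%:R <= K ->
    iter i phi x j = iter i phi y j.
  elim: n i j => [|n IH] i j.
    by rewrite subr0 => hij; apply: e; rewrite ler_norml.
  move=> /andP[lo hi]; rewrite -natr1 in lo.
  have [lo'|lo'] := leP (- K - n%:R) (j%:~R - r * i%:R); first by apply: IH; apply/andP.
  have ci := cellular_iter i h.
  have Xi z : X z -> X (iter i phi z) by move=> Xz; apply: (cel_map ci).
  suff : shift (j + 1) (iter i phi x) (-1) = shift (j + 1) (iter i phi y) (-1).
    by rewrite /shift (_ : -1 + (j + 1) = j); last by lia.
  apply: hT; [exact: cel_shift h _ _ (Xi x Xx)|exact: cel_shift h _ _ (Xi y Xy)|].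
  move=> i' j' hi' hj' hij'; have ci' := cellular_iter i' h.
  rewrite !(cel_comm ci'); [|exact: Xi|exact: Xi].
  rewrite /shift -!iterD; apply: IH.
  have n0 : (0 : R) <= n%:R by [].
  have hi'' : `|i'%:Z| <= T%:Z by lia.
  have := strip_width (d := j%:~R - r * i%:R) (K := K) hi'' hj' hij' erefl.
  rewrite !intrD natrD mulrDr => H; apply/andP; split; first by lra.
  have : j%:~R - r * i%:R < - K by lra.
  move=> /H; rewrite -[(i'%:Z)%:~R]/(i'%:R); lra.
have [n hn] := filter_ex (nbhs_infty_gtr (r * i0%:R - j0%:~R)).
apply: (grow n); apply/andP; lra.
Qed.
End Strip.

(** * Exchanging left and right *)

Section Reflection.
Context {R : realType} (A : finType).
Implicit Types (X : set (config A)) (phi : config A -> config A) (r : R).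

(** Exchanges left and right; conjugating by it turns each statement about one
    side into the statement about the other with [r] replaced by [- r]. *)
Definition mirror (x : config A) : config A := fun j => x (- j).
Definition mirror_set X : set (config A) := [set x | X (mirror x)].
Definition mirror_map phi : config A -> config A := fun x => mirror (phi (mirror x)).

Lemma mirrorK : involutive mirror.
Proof. by move=> x; apply/funext => j; rewrite /mirror opprK. Qed.

Lemma mirror_setK : involutive mirror_set.
Proof. by move=> X; apply/seteqP; split => x; rewrite /mirror_set /= mirrorK. Qed.

Lemma mirror_mapK : involutive mirror_map.
Proof. by move=> phi; apply/funext => x; rewrite /mirror_map !mirrorK. Qed.

Lemma mirror_shift k x : mirror (shift k x) = shift (- k) (mirror x).
Proof. by apply/funext => j; rewrite /mirror /shift; congr x; lia. Qed.

Lemma iter_mirror s phi : iter s (mirror_map phi) = mirror_map (iter s phi).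
Proof.
apply/funext => x; elim: s => [|s IH] /=; first by rewrite /mirror_map /= mirrorK.
by rewrite IH /mirror_map mirrorK.
Qed.

Lemma cellular_mirror X phi :
  cellular X phi -> cellular (mirror_set X) (mirror_map phi).
Proof.
move=> h; split.
- move=> v hv; apply: (cel_closed h) => w; have [x Xx e] := hv w.
  by exists (mirror x) => // j jw; rewrite /mirror e // normrN.
- by move=> k x Xx; rewrite /mirror_set /= mirror_shift; apply: (cel_shift h).
- by move=> x Xx; rewrite /mirror_set /= /mirror_map mirrorK; apply: (cel_map h).
- by move=> k x Xx; rewrite /mirror_map mirror_shift (cel_comm h) // mirror_shift opprK.
- have [m hm] := cel_radius h; exists m => x y Xx Xy e.
  rewrite /mirror_map /mirror oppr0; apply: hm => // j jm.
  by rewrite /mirror e // normrN.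
Qed.

Lemma orbit_mirror X phi x : is_orbit X phi x ->
  is_orbit (mirror_set X) (mirror_map phi) (fun i => mirror (x i)).
Proof.
move=> [Xx hx]; split => i; first by rewrite /mirror_set /= mirrorK.
by rewrite /mirror_map mirrorK hx.
Qed.

Lemma orb_sep_mirror X phi (S : int -> int -> Prop) :
  orb_sep X phi (fun i j => S i (- j)) ->
  orb_sep (mirror_set X) (mirror_map phi) S.
Proof.
move=> sep x y /orbit_mirror + /orbit_mirror; rewrite mirror_setK mirror_mapK.
move=> hx hy e; have E := sep _ _ hx hy (fun i j => e i (- j)).
by apply/funext => i; apply: (can_inj mirrorK); have := congr1 (fun z => z i) E.
Qed.

Lemma orb_sep_mirrorE X phi (S S' : int -> int -> Prop) :
  (forall i j, S i (- j) <-> S' i j) ->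
  orb_sep (mirror_set X) (mirror_map phi) S <-> orb_sep X phi S'.
Proof.
move=> SS'.
have -> : S' = (fun i j => S i (- j)).
  by apply/funext => i; apply/funext => j; apply/propext; rewrite SS'.
split; last exact: orb_sep_mirror.
have e : S = (fun i j => S i (- - j)).
  by apply/funext => i; apply/funext => j; rewrite opprK.
move=> sep; rewrite -(mirror_setK X) -(mirror_mapK phi).
by apply: orb_sep_mirror; rewrite -e.
Qed.

Lemma pt_sep_mirror X phi (S : nat -> int -> Prop) :
  pt_sep X phi (fun i j => S i (- j)) ->
  pt_sep (mirror_set X) (mirror_map phi) S.
Proof.
move=> sep x y Xx Xy e; apply: (can_inj mirrorK); apply: sep => // i j Sij.
by have := e i (- j) Sij; rewrite iter_mirror /mirror_map /mirror opprK.
Qed.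

Lemma pt_sep_mirrorE X phi (S S' : nat -> int -> Prop) :
  (forall i j, S i (- j) <-> S' i j) ->
  pt_sep (mirror_set X) (mirror_map phi) S <-> pt_sep X phi S'.
Proof.
move=> SS'.
have -> : S' = (fun i j => S i (- j)).
  by apply/funext => i; apply/funext => j; apply/propext; rewrite SS'.
split; last exact: pt_sep_mirror.
have e : S = (fun i j => S i (- - j)).
  by apply/funext => i; apply/funext => j; rewrite opprK.
move=> sep; rewrite -(mirror_setK X) -(mirror_mapK phi).
by apply: pt_sep_mirror; rewrite -e.
Qed.

Definition right_reach X phi (p : int) : Prop := forall x y, X x -> X y ->
  (forall j : int, j <= 0 -> x j = y j) -> phi x p = phi y p.

Definition left_recovery X phi (q : int) : Prop := forall x y, X x -> X y ->
  (forall j : int, 0 <= j -> x j = y j) ->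
  (forall j : int, q - 1 <= j -> phi x j = phi y j) -> x (- 1) = y (- 1).

Definition right_reach_rate X phi : \bar R :=
  slope_sup (fun s => right_reach X (iter s phi)).

Definition left_recovery_rate X phi : \bar R :=
  slope_sup (fun s => left_recovery X (iter s phi)).

Lemma right_reachE X phi :
  right_reach X phi = left_reach (mirror_set X) (mirror_map phi).
Proof.
apply/funext => p; apply/propext; split => hp x y Xx Xy e.
  rewrite /mirror_map /mirror opprK; apply: hp => // j j0.
  by apply: e; lia.
have mE z : mirror (phi z) (- p) = phi z p by rewrite /mirror opprK.
have := hp (mirror x) (mirror y); rewrite /mirror_set /mirror_map /= !mirrorK !mE.
by apply => // j j0; apply: e; lia.
Qed.

Lemma left_recoveryE X phi :
  left_recovery X phi = right_recovery (mirror_set X) (mirror_map phi).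
Proof.
apply/funext => q; apply/propext; split => hq x y Xx Xy e e'.
  apply: (hq (mirror x) (mirror y)) => // j hj; first by apply: e; lia.
  by have := e' (- j); rewrite /mirror_map /mirror opprK; apply; lia.
have := hq (mirror x) (mirror y); rewrite /mirror_set /= !mirrorK; apply => // j hj.
  by apply: e; lia.
by rewrite /mirror_map !mirrorK; apply: e'; lia.
Qed.

Lemma right_reach_rateE X phi :
  right_reach_rate X phi = left_reach_rate (mirror_set X) (mirror_map phi).
Proof.
by congr slope_sup; apply/funext => s; rewrite right_reachE iter_mirror.
Qed.

Lemma left_recovery_rateE X phi :
  left_recovery_rate X phi = right_recovery_rate (mirror_set X) (mirror_map phi).
Proof.
by congr slope_sup; apply/funext => s; rewrite left_recoveryE iter_mirror.
Qed.

Lemma mirror_right_sep X phi r :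
  right_sep (mirror_set X) (mirror_map phi) (- r) <-> left_sep X phi r.
Proof. by apply: orb_sep_mirrorE => i j; rewrite intrN mulNr lerN2. Qed.

Lemma mirror_left_sep X phi r :
  left_sep (mirror_set X) (mirror_map phi) (- r) <-> right_sep X phi r.
Proof. by apply: orb_sep_mirrorE => i j; rewrite intrN mulNr lerN2. Qed.

Lemma mirror_right_sep_up X phi r :
  right_sep_up (mirror_set X) (mirror_map phi) (- r) <-> left_sep_up X phi r.
Proof. by apply: orb_sep_mirrorE => i j; rewrite intrN mulNr lerN2. Qed.

Lemma mirror_pos_left_sep X phi r :
  pos_left_sep (mirror_set X) (mirror_map phi) (- r) <-> pos_right_sep X phi r.
Proof. by apply: pt_sep_mirrorE => i j; rewrite intrN mulNr lerN2. Qed.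

Lemma left_sep_upP X phi r : cellular X phi ->
  left_sep_up X phi r <-> (r%:E < right_reach_rate X phi)%E.
Proof.
move=> /cellular_mirror h; rewrite -mirror_right_sep_up right_sep_upP //.
by rewrite right_reach_rateE EFinN lteN2.
Qed.

Lemma pos_right_sepP X phi r : cellular X phi ->
  pos_right_sep X phi r <-> (r%:E < left_recovery_rate X phi)%E.
Proof.
move=> /cellular_mirror h; rewrite -mirror_pos_left_sep pos_left_sepP //.
by rewrite left_recovery_rateE EFinN lteN2.
Qed.

Lemma left_sep_up_sep X phi r : cellular X phi ->
  left_sep_up X phi r -> left_sep X phi r.
Proof.
move=> /cellular_mirror h; rewrite -mirror_right_sep_up -mirror_right_sep.
exact: right_sep_up_sep.
Qed.

Lemma pos_right_sep_orbit X phi r : cellular X phi ->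
  pos_right_sep X phi r -> right_sep X phi r.
Proof.
move=> /cellular_mirror h; rewrite -mirror_pos_left_sep -mirror_left_sep.
exact: pos_left_sep_orbit.
Qed.

Lemma right_reach_rate_gt X phi : cellular X phi ->
  (-oo < right_reach_rate X phi :> \bar R)%E.
Proof. by move=> /cellular_mirror h; rewrite right_reach_rateE left_reach_rate_gt. Qed.

Lemma left_sep_reach_critical X phi (l : R) : cellular X phi ->
  right_reach_rate X phi = l%:E -> ~ left_sep X phi l.
Proof.
move=> /cellular_mirror h; rewrite right_reach_rateE -mirror_right_sep.
exact: right_sep_critical.
Qed.

Lemma right_sep_recovery_critical X phi (l : R) : cellular X phi ->
  left_recovery_rate X phi = l%:E -> ~ right_sep X phi l.
Proof.
move=> /cellular_mirror h; rewrite left_recovery_rateE -mirror_left_sep => hl.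
exact: (left_sep_critical h hl).1.
Qed.
End Reflection.

(** * Intervals as connected components *)

Section Intervals.
Context {R : realType}.
Implicit Types (a b : \bar R) (E : set R).

Lemma interv_interval a b : is_interval (interv a b).
Proof.
move=> x y [ax xb] [ay yb] z /andP[xz zy]; split.
  by apply: lt_le_trans ax _; rewrite lee_fin.
by apply: le_lt_trans yb; rewrite lee_fin.
Qed.

(** A connected set leaving the interval would contain one of its ends. *)
Lemma interv_component a b E x : interv a b `<=` E ->
  (forall r, r%:E = a \/ r%:E = b -> ~ E r) -> interv a b x ->
  connected_component E x = interv a b.
Proof.
move=> sub ends abx; have /connected_intervalP itv := @component_connected _ E x.
have Ex : E x by exact: sub.
have Cx := connected_component_refl Ex; have [ax xb] := abx.
have hE r : connected_component E x r -> E r by exact: connected_component_sub.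
apply/seteqP; split=> [y Cy|]; last first.
  apply: connected_component_max => //.
  exact/connected_intervalP/interv_interval.
split; rewrite ltNge; apply/negP => le_y.
  case: a ends ax le_y {abx sub} => [r| |] // ends; rewrite lte_fin lee_fin => rx yr.
  apply: (ends r); [by left|]; apply: hE; apply: (itv y x) => //.
  by rewrite yr ltW.
case: b ends xb le_y {abx sub} => [r| |] // ends; rewrite lte_fin lee_fin => xr ry.
apply: (ends r); [by right|]; apply: hE; apply: (itv x y) => //.
by rewrite ry ltW.
Qed.

Lemma interv_is_component a b E : interv a b !=set0 -> interv a b `<=` E ->
  (forall r, r%:E = a \/ r%:E = b -> ~ E r) -> is_component E (interv a b).
Proof.
by move=> [x abx] sub ends; exists x; [exact: sub|rewrite (interv_component sub ends abx)].
Qed.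

Lemma interv_right_component a E : (a < +oo)%E -> interv a +oo%E `<=` E ->
  (forall r, r%:E = a -> ~ E r) -> is_right_unbounded_component E (interv a +oo%E).
Proof.
move=> ay sub ends.
have ends' r : r%:E = a \/ r%:E = +oo%E -> ~ E r by case=> // /ends.
have above z : exists2 x, z < x & interv a +oo%E x.
  case: a ay sub ends ends' => [r| |] // _ _ _ _.
    exists (Num.max z r + 1); last first.
      by split; rewrite ?ltry // lte_fin ltr_pwDr // le_max lexx orbT.
    by rewrite ltr_pwDr // le_max lexx.
  by exists (z + 1); [lra|split; rewrite ?ltry ?ltNyr].
apply/seteqP; split => [D [[x Ex ->] unb]|D ->] /=.
  have [x0 _ ax0] := above 0.
  have [y Cy x0y] : exists2 y, connected_component E x y & x0 < y.
    apply: contrapT => no; apply: unb; exists x0 => y Cy.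
    by rewrite leNgt; apply/negP => lt; apply: no; exists y.
  rewrite (same_connected_component Cy); apply: interv_component => //.
  by split; rewrite ?ltry //; apply: lt_trans ax0.1 _; rewrite lte_fin.
split.
  by apply: interv_is_component => //; have [x _ ?] := above 0; exists x.
by move=> [z hz]; have [x zx /hz] := above z; rewrite leNgt zx.
Qed.

Lemma interv_left_component b E : (-oo < b)%E -> interv -oo%E b `<=` E ->
  (forall r, r%:E = b -> ~ E r) -> is_left_unbounded_component E (interv -oo%E b).
Proof.
move=> by_ sub ends.
have ends' r : r%:E = -oo%E \/ r%:E = b -> ~ E r by case=> // /ends.
have below z : exists2 x, x < z & interv -oo%E b x.
  case: b by_ sub ends ends' => [r| |] // _ _ _ _.
    exists (Num.min z r - 1); last first.
      by split; rewrite ?ltNyr // lte_fin ltrBlDr ltr_pwDr // ge_min lexx orbT.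
    by rewrite ltrBlDr ltr_pwDr // ge_min lexx.
  by exists (z - 1); [lra|split; rewrite ?ltry ?ltNyr].
apply/seteqP; split => [D [[x Ex ->] unb]|D ->] /=.
  have [x0 _ ax0] := below 0.
  have [y Cy x0y] : exists2 y, connected_component E x y & y < x0.
    apply: contrapT => no; apply: unb; exists x0 => y Cy.
    by rewrite leNgt; apply/negP => lt; apply: no; exists y.
  rewrite (same_connected_component Cy); apply: interv_component => //.
  by split; rewrite ?ltNyr //; apply: lt_trans _ ax0.2; rewrite lte_fin.
split.
  by apply: interv_is_component => //; have [x _ ?] := below 0; exists x.
by move=> [z hz]; have [x zx /hz] := below z; rewrite leNgt zx.
Qed.
End Intervals.

(** * Topology and metric in terms of coordinates *)

Section Topology.
Context {R : realType} (A : finType).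
Implicit Types (X : set (config A)) (phi : config A -> config A).
Implicit Types (d : config A -> config A -> R).

(** Otherwise points agreeing with [v] on larger and larger windows but outside
    [U] would converge to [v]. *)
Lemma nbhs_cylinder (v : config A) (U : set (config A)) : nbhs v U ->
  exists w : nat, forall y : config A, (forall j : int, `|j| <= w%:Z -> y j = v j) -> U y.
Proof.
move=> vU; apply: contrapT => /forallNP no.
have /choice [y hy] : forall w : nat, exists y : config A,
    (forall j : int, `|j| <= w%:Z -> y j = v j) /\ ~ U y.
  by move=> w; have /existsNP[y /not_implyP] := no w; exists y.
have cvg : y w @[w --> \oo] --> v.
  apply/cvg_sup => j V [_ [[W oW <-] Wv /filterS]]; apply.
  suff : \forall w \near \oo, W (y w j) by [].
  near=> w; rewrite (_ : y w j = v j) //; apply: (hy w).1.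
  have : (absz j <= w)%N by near: w; exact: nbhs_infty_ge.
  lia.
have : \forall w \near \oo, U (y w) by exact: cvg.
by case/filter_ex => w; apply: (hy w).2.
Unshelve. all: by end_near. Qed.

Lemma coordinate_nbhs (v : config A) (j : int) : \forall y \near v, y j = v j.
Proof.
apply: (@proj_continuous int (fun _ => discrete_topology A) j v [set a | a = v j]).
by rewrite nbhs_principalE.
Qed.

Lemma int_walk (P : int -> Prop) : P 0 -> (forall k, P k -> P (k + 1)) ->
  (forall k, P k -> P (k - 1)) -> forall k, P k.
Proof.
move=> P0 up down k; have [k0|k0] := leP 0 k.
  have -> : k = (absz k)%:Z by lia.
  elim: (absz k) => // n /up; rewrite (_ : n%:Z + 1 = n.+1%:Z) //; lia.
have -> : k = - (absz k)%:Z by lia.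
elim: (absz k) => // n /down; rewrite (_ : - n%:Z - 1 = - n.+1%:Z) //; lia.
Qed.

Lemma shiftD (k l : int) (x : config A) : shift k (shift l x) = shift (l + k) x.
Proof. by apply/funext => j; rewrite /shift -addrA (addrC k). Qed.

Lemma shift0 (x : config A) : shift 0 x = x.
Proof. by apply/funext => j; rewrite /shift addr0. Qed.

Lemma subshift_pred X x : subshift X -> X x -> X (shift (-1) x).
Proof.
move=> [_ sX]; rewrite -[in X in X -> _]sX => -[z Xz <-].
by rewrite shiftD subrr shift0.
Qed.

Lemma subshift_shift X k x : subshift X -> X x -> X (shift k x).
Proof.
move=> hX Xx; move: k; apply: int_walk; first by rewrite shift0.
  by move=> k Xk; rewrite -shiftD; case: hX => _ <-; exists (shift k x).
by move=> k Xk; rewrite -shiftD; apply: subshift_pred.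
Qed.

Lemma endomorphism_shift X phi k x : subshift X -> endomorphism X phi -> X x ->
  phi (shift k x) = shift k (phi x).
Proof.
move=> hX [maps _ comm] Xx; move: k.
have Xk k : X (shift k x) by exact: subshift_shift.
apply: int_walk; first by rewrite !shift0.
  by move=> k e; rewrite -!shiftD comm // e.
move=> k e; apply: (@shift_inj A 1); rewrite -comm //.
by rewrite !shiftD subrK e.
Qed.

Lemma subshift_closed X (v : config A) : subshift X ->
  (forall w : nat, exists2 x, X x & forall j : int, `|j| <= w%:Z -> x j = v j) ->
  X v.
Proof.
move=> [clX _] hv; apply: clX => U /nbhs_cylinder [w hw].
by have [x Xx e] := hv w; exists x; split => //; apply: hw.
Qed.

Lemma subshift_cluster X (x : nat -> config A) : subshift X -> (forall n, X (x n)) ->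
  exists (U : set_system nat) (v : config A), [/\ ProperFilter U, \oo `<=` U, X v &
    forall w : nat, \forall n \near U, forall j : int, `|j| <= w%:Z -> x n j = v j].
Proof.
move=> hX Xx; have [U [v [FU oU hv]]] := @pointwise_cluster A int x.
exists U, v; split => //; last exact: near_window hv.
apply: (subshift_closed hX) => w.
by have [n hn] := filter_ex (near_window hv w); exists (x n).
Qed.

(** Otherwise pairs agreeing on larger and larger windows, but with images that
    differ at 0, would have a common limit at which [phi] is not continuous. *)
Lemma endomorphism_radius X phi : subshift X -> endomorphism X phi ->
  exists m : nat, forall x y, X x -> X y ->
    (forall j : int, `|j| <= m%:Z -> x j = y j) -> phi x 0 = phi y 0.
Proof.
move=> hX [maps cont comm]; apply: contrapT => /forallNP no.
have /choice [x /choice [y hxy]] : forall m : nat, exists x y, [/\ X x, X y,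
    forall j : int, `|j| <= m%:Z -> x j = y j & phi x 0 <> phi y 0].
  move=> m; have /existsNP[x /existsNP[y]] := no m.
  move=> /not_implyP[Xx /not_implyP[Xy /not_implyP[e ne]]].
  by exists x, y.
have Xx n : X (x n) by have [] := hxy n.
have [U [v [FU oU Xv hv]]] := subshift_cluster hX Xx.
have /subspace_continuousP /(_ v Xv) cv := cont.
have /nbhs_cylinder [w hw] := cv _ (coordinate_nbhs (phi v) 0).
have large : \forall n \near U, (w <= n)%N by apply: oU; exact: nbhs_infty_ge.
have [n [en wn]] := filter_ex (filterI (hv w) large).
have loc z : X z -> (forall j : int, `|j| <= w%:Z -> z j = v j) -> phi z 0 = phi v 0.
  by move=> Xz /hw; apply.
have [_ Xy e ne] := hxy n; apply: ne.
rewrite (loc (x n)) // (loc (y n)) // => j jw; rewrite -en // e //; lia.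
Qed.

Lemma endomorphism_cellular X phi : subshift X -> endomorphism X phi ->
  cellular X phi.
Proof.
move=> hX hphi; split.
- by move=> v; apply: subshift_closed.
- by move=> k x; apply: subshift_shift.
- by move=> x Xx; have [maps _ _] := hphi; apply: maps.
- by move=> k x; apply: endomorphism_shift.
- exact: endomorphism_radius.
Qed.

Lemma metric_cylinder X d (v : config A) (e : R) : compatible_metric X d ->
  X v -> 0 < e -> exists w : nat, forall y, X y ->
    (forall j : int, `|j| <= w%:Z -> y j = v j) -> d v y < e.
Proof.
move=> [_ _ _ _ nb] Xv e0.
have : within X (nbhs v) (X `&` [set y | d v y < e]) by rewrite nb //; exists e.
by move=> /nbhs_cylinder [w hw]; exists w => y Xy /hw /(_ Xy)[].
Qed.

(** Points at distance tending to 0 have limits at distance 0, that is, equal. *)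
Lemma metric_coordinate X d : subshift X -> compatible_metric X d ->
  exists2 delta : R, 0 < delta & forall x y, X x -> X y -> d x y <= delta -> x 0 = y 0.
Proof.
move=> hX hd; apply: contrapT => no.
have /choice [x /choice [y hxy]] : forall n : nat, exists x y, [/\ X x, X y,
    d x y <= n.+1%:R^-1 & x 0 <> y 0].
  move=> n; apply: contrapT => /forallNP none; apply: no.
  exists n.+1%:R^-1; first by rewrite invr_gt0 ltr0n.
  move=> x y Xx Xy dxy; apply: contrapT => ne; apply: (none x); by exists y.
have Xx n : X (x n) by have [] := hxy n.
have Xy n : X (y n) by have [] := hxy n.
pose u n (p : bool * int) : A := if p.1 then x n p.2 else y n p.2.
have [U [v [FU oU hv]]] := pointwise_cluster u.
have winx := near_window (P := fun n j => x n j = v (true, j)) (fun j => hv (true, j)).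
have winy := near_window (P := fun n j => y n j = v (false, j)) (fun j => hv (false, j)).
have Xvx : X (fun j => v (true, j)).
  apply: (subshift_closed hX) => w.
  by have [n hn] := filter_ex (winx _ w); exists (x n).
have Xvy : X (fun j => v (false, j)).
  apply: (subshift_closed hX) => w.
  by have [n hn] := filter_ex (winy _ w); exists (y n).
set vx : config A := fun j => v (true, j) in Xvx.
set vy : config A := fun j => v (false, j) in Xvy.
have [d0 dE dS dT _] := hd.
have vxy : vx = vy.
  apply/(dE _ _ Xvx Xvy)/eqP; rewrite eq_le d0 // andbT leNgt; apply/negP => pos.
  have e0 : 0 < d vx vy / 3 by apply: divr_gt0.
  have [w1 hw1] := metric_cylinder hd Xvx e0.
  have [w2 hw2] := metric_cylinder hd Xvy e0.
  have small : \forall n \near U, n.+1%:R^-1 < d vx vy / 3.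
    by apply: oU; exact: (near_infty_natSinv_lt (PosNum e0)).
  have [n [[en1 en2] sn]] := filter_ex (filterI (filterI (winx _ w1) (winy _ w2)) small).
  have {}sn : n.+1%:R^-1 < d vx vy / 3 by exact: sn.
  have [_ _ dn _] := hxy n.
  have := hw1 _ (Xx n) en1; have := hw2 _ (Xy n) en2.
  have := dT _ _ _ Xvx (Xx n) Xvy; have := dT _ _ _ (Xx n) (Xy n) Xvy.
  have := le_lt_trans dn sn; rewrite (dS (y n)) //; lra.
have [n [en1 en2]] := filter_ex (filterI (hv (true, 0)) (hv (false, 0))).
have [_ _ _ ne] := hxy n; apply: ne; rewrite -[x n 0]/(u n (true, 0)) en1.
by rewrite -[y n 0]/(u n (false, 0)) en2 -[LHS]/(vx 0) vxy.
Qed.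

Lemma metric_window X d (delta : R) : subshift X -> compatible_metric X d ->
  0 < delta -> exists w : nat, forall x y, X x -> X y ->
    (forall j : int, `|j| <= w%:Z -> x j = y j) -> d x y <= delta.
Proof.
move=> hX hd d0; apply: contrapT => /forallNP no.
have /choice [x /choice [y hxy]] : forall m : nat, exists x y, [/\ X x, X y,
    forall j : int, `|j| <= m%:Z -> x j = y j & ~ d x y <= delta].
  move=> m; have /existsNP[x /existsNP[y]] := no m.
  move=> /not_implyP[Xx /not_implyP[Xy /not_implyP[e ne]]].
  by exists x, y.
have Xx n : X (x n) by have [] := hxy n.
have [U [v [FU oU Xv hv]]] := subshift_cluster hX Xx.
have e0 : 0 < delta / 2 by apply: divr_gt0.
have [w hw] := metric_cylinder hd Xv e0.
have large : \forall n \near U, (w <= n)%N by apply: oU; exact: nbhs_infty_ge.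
have [n [en wn]] := filter_ex (filterI (hv w) large).
have [_ Xy e ne] := hxy n; apply: ne; have [_ _ dS dT _] := hd.
have h1 := hw _ (Xx n) en.
have h2 : d v (y n) < delta / 2.
  by apply: hw => // j jw; rewrite -en // e //; lia.
have := dT _ _ _ (Xx n) Xv Xy; rewrite (dS (x n) v) //; lra.
Qed.

(** One [delta] detecting the coordinate 0 detects each [(i, j)] of [S] after a
    shift by [j]. *)
Lemma orb_sep_separated X phi d S : subshift X -> compatible_metric X d ->
  orb_sep X phi S -> exists2 delta, 0 < delta & orbits_separated_on X phi d S delta.
Proof.
move=> hX hd sep; have [delta d0 hdelta] := metric_coordinate hX hd.
exists delta => // x y hx hy e; apply: sep => // i j Sij.
have := hdelta _ _ (subshift_shift j hX (hx.1 i)) (subshift_shift j hX (hy.1 i)) (e i j Sij).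
by rewrite /shift add0r.
Qed.

Lemma separated_orb_sep X phi d S (delta : R) : subshift X -> compatible_metric X d ->
  0 < delta -> orbits_separated_on X phi d S delta ->
  exists w : nat, orb_sep X phi (fun i j => exists2 k, S i k & `|j - k| <= w%:Z).
Proof.
move=> hX hd d0 sep; have [w hw] := metric_window hX hd d0.
exists w => x y hx hy e; apply: sep => // i k Sik.
apply: hw => [||j jw].
- exact: (subshift_shift k hX (hx.1 i)).
- exact: (subshift_shift k hX (hy.1 i)).
- by apply: e; exists k => //; rewrite addrK.
Qed.

Lemma pt_sep_separated X phi d S : subshift X -> compatible_metric X d ->
  cellular X phi -> pt_sep X phi S ->
  exists2 delta, 0 < delta & points_separated_on X phi d S delta.
Proof.
move=> hX hd h sep; have [delta d0 hdelta] := metric_coordinate hX hd.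
exists delta => // x y Xx Xy e; apply: sep => // i j Sij.
have Xi z : X z -> X (iter i phi z) by exact: cel_map (cellular_iter i h) _.
have := hdelta _ _ (subshift_shift j hX (Xi _ Xx)) (subshift_shift j hX (Xi _ Xy)) (e i j Sij).
by rewrite /shift add0r.
Qed.

Lemma separated_pt_sep X phi d S (delta : R) : subshift X -> compatible_metric X d ->
  cellular X phi -> 0 < delta -> points_separated_on X phi d S delta ->
  exists w : nat, pt_sep X phi (fun i j => exists2 k, S i k & `|j - k| <= w%:Z).
Proof.
move=> hX hd h d0 sep; have [w hw] := metric_window hX hd d0.
exists w => x y Xx Xy e; apply: sep => // i k Sik.
have Xi z : X z -> X (iter i phi z) by exact: cel_map (cellular_iter i h) _.
apply: hw => [||j jw].
- exact: (subshift_shift k hX (Xi _ Xx)).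
- exact: (subshift_shift k hX (Xi _ Xy)).
- by apply: e; exists k => //; rewrite addrK.
Qed.
End Topology.

(** * The sets of expansive directions *)

Section DirectionSets.
Context {R : realType} (A : finType) (X : set (config A)) (phi : config A -> config A).
Context (d : config A -> config A -> R).
Hypotheses (hX : subshift X) (hd : compatible_metric X d) (h : cellular X phi).

Lemma window_shift (k j : int) (w : nat) : `|j - k| <= w%:Z ->
  k%:~R - w%:R <= j%:~R :> R /\ j%:~R <= k%:~R + w%:R :> R.
Proof.
rewrite -(ler_int R) intr_norm ler_norml intrB -[(w%:Z)%:~R]/(w%:R) => /andP[]; lra.
Qed.

Lemma right_expansiveE r : right_expansive X phi d r <-> right_sep X phi r.
Proof.
split=> [[delta d0 /(separated_orb_sep hX hd d0) [w]]|]; last exact: orb_sep_separated.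
apply: (orb_sepS (c := w%:Z) h) => i j [k hk /window_shift[]].
rewrite intrD -[(w%:Z)%:~R]/(w%:R); lra.
Qed.

Lemma left_expansiveE r : left_expansive X phi d r <-> left_sep X phi r.
Proof.
split=> [[delta d0 /(separated_orb_sep hX hd d0) [w]]|]; last exact: orb_sep_separated.
apply: (orb_sepS (c := - w%:Z) h) => i j [k hk /window_shift[]].
rewrite intrD intrN -[(w%:Z)%:~R]/(w%:R); lra.
Qed.

Lemma right_expansive_upperE r : right_expansive_upper X phi d r <-> right_sep_up X phi r.
Proof.
split=> [[delta d0 /(separated_orb_sep hX hd d0) [w]]|]; last exact: orb_sep_separated.
apply: (orb_sepS (c := w%:Z) h) => i j [k [i0 hk] /window_shift[h1 h2]]; split => //.
rewrite intrD -[(w%:Z)%:~R]/(w%:R); lra.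
Qed.

Lemma left_expansive_upperE r : left_expansive_upper X phi d r <-> left_sep_up X phi r.
Proof.
split=> [[delta d0 /(separated_orb_sep hX hd d0) [w]]|]; last exact: orb_sep_separated.
apply: (orb_sepS (c := - w%:Z) h) => i j [k [i0 hk] /window_shift[h1 h2]]; split => //.
rewrite intrD intrN -[(w%:Z)%:~R]/(w%:R); lra.
Qed.

Lemma expansiveE r : expansive X phi d r <-> strip_sep X phi r.
Proof.
split=> [[delta [t [d0 t0 /(separated_orb_sep hX hd d0) [w sep]]]]|[t t0]].
  exists (t + w%:R); first exact: addr_ge0.
  apply: (orb_sepS (c := 0) h) sep => i j [k hk /window_shift[h1 h2]].
  move: hk; rewrite addr0 !ler_norml => /andP[h3 h4]; apply/andP; lra.
by case/(orb_sep_separated hX hd) => delta d0 sep; exists delta, t.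
Qed.

Lemma pos_left_expansiveE r : pos_left_expansive X phi d r <-> pos_left_sep X phi r.
Proof.
split=> [[delta d0 /(separated_pt_sep hX hd h d0) [w]]|]; last exact: pt_sep_separated.
apply: (pt_sepS (c := - w%:Z) h) => i j [k hk /window_shift[]].
rewrite intrD intrN -[(w%:Z)%:~R]/(w%:R); lra.
Qed.

Lemma pos_right_expansiveE r : pos_right_expansive X phi d r <-> pos_right_sep X phi r.
Proof.
split=> [[delta d0 /(separated_pt_sep hX hd h d0) [w]]|]; last exact: pt_sep_separated.
apply: (pt_sepS (c := w%:Z) h) => i j [k hk /window_shift[]].
rewrite intrD -[(w%:Z)%:~R]/(w%:R); lra.
Qed.

Lemma pos_expansiveE r : pos_expansive X phi d r <-> pos_strip_sep X phi r.
Proof.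
split=> [[delta [t [d0 t0 /(separated_pt_sep hX hd h d0) [w sep]]]]|[t t0]].
  exists (t + w%:R); first exact: addr_ge0.
  apply: (pt_sepS (c := 0) h) sep => i j [k hk /window_shift[h1 h2]].
  move: hk; rewrite addr0 !ler_norml => /andP[h3 h4]; apply/andP; lra.
by case/(pt_sep_separated hX hd h) => delta d0 sep; exists delta, t.
Qed.
End DirectionSets.

(** * Degrees of local rules *)

Section StrictDegrees.
Context {R : realType}.
Implicit Types (P : int -> Prop) (red mrg : nat -> Prop).

Lemma degree_max P p : P p -> (forall q, P q -> q <= p) -> degree P = p%:~R%:E :> \bar R.
Proof.
move=> Pp pmax; apply/eqP; rewrite eq_le; apply/andP; split.
  by apply: ge_ereal_sup => _ [q Pq <-]; rewrite lee_fin ler_int; apply: pmax.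
by apply: ereal_sup_ubound; exists p.
Qed.

Lemma strictly_redundant_degree P (m : nat) red (I : \bar R) :
  (forall p q, q <= p -> P p -> P q) -> (forall i, red i <-> P (i%:Z - m%:Z)) ->
  strictly_redundant red I -> (I - m%:R%:E)%E = degree P.
Proof.
move=> down redP [[i -> [/redP Pi nPi]]|[-> all]].
  rewrite (@degree_max P (i%:Z - m%:Z)) //; first by rewrite intrB.
  move=> q Pq; rewrite leNgt; apply/negP => lt; apply: nPi; apply/redP.
  by apply: down Pq; lia.
apply/esym/eq_infty => r.
have Pall q : P q by apply: down ((redP (absz (q + m%:Z)%R)).1 (all _)); lia.
apply: (@le_trans _ _ (Num.floor r + 1)%:~R%:E); last first.
  by apply: ereal_sup_ubound; exists (Num.floor r + 1).
by rewrite lee_fin ltW // floorD1_gt.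
Qed.

(** The hypothesis on [n + 1] is what makes the value independent of the rule: a
    property holding beyond [n] could not be seen through [k >= 0]. *)
Lemma strictly_mergible_degree P (n : nat) mrg (k : \bar R) :
  (forall p q, q <= p -> P p -> P q) -> (forall i, mrg i <-> P (n%:Z - i%:Z)) ->
  ~ P (n%:Z + 1) -> strictly_mergible mrg k -> (n%:R%:E - k)%E = degree P.
Proof.
move=> down mrgP top.
have le_n q : P q -> q <= n%:Z.
  by move=> Pq; rewrite leNgt; apply/negP => lt; apply: top; apply: down Pq; lia.
case=> [[i -> [/mrgP Pi min]]|[-> none]].
  rewrite (@degree_max P (n%:Z - i%:Z)) //; first by rewrite intrB.
  move=> q Pq; have qn := le_n q Pq; rewrite leNgt; apply/negP => lt.
  apply: (min (absz (n%:Z - q)%R)); first by lia.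
  by apply/mrgP; apply: down Pq; lia.
rewrite /degree (_ : [set _ | _ in _] = set0) ?ereal_sup0 //.
apply/seteqP; split => // c [q Pq _]; have qn := le_n q Pq.
apply: (none (absz (n%:Z - q)%R)); apply/mrgP; apply: down Pq; lia.
Qed.

Lemma strictly_redundant_ex red : red 0%N -> exists I : \bar R, strictly_redundant red I.
Proof.
move=> red0; have [all|/existsNP[j nj]] := pselect (forall i, red i).
  by exists +oo%E; right.
have ex : exists i, `[< ~ red i >] by exists j; apply/asboolP.
case: (ex_minnP ex) => -[|i] /asboolP ni min; first by [].
exists i%:R%:E; left; exists i => //; split => //.
by apply: contrapT => /asboolT /min; rewrite ltnn.
Qed.

Lemma strictly_mergible_ex mrg : exists k : \bar R, strictly_mergible mrg k.
Proof.
have [none|/existsNP[j /contrapT hj]] := pselect (forall i, ~ mrg i).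
  by exists +oo%E; right.
have ex : exists i, `[< mrg i >] by exists j; apply/asboolP.
case: (ex_minnP ex) => i /asboolP hi min.
exists i%:R%:E; left; exists i => //; split => // k ki /asboolT /min.
by rewrite leqNgt ki.
Qed.
End StrictDegrees.

Section LocalRuleDegrees.
Context {R : realType} (A : finType).
Implicit Types (X : set (config A)) (phi : config A -> config A).

Lemma eq_word N (a b : config A) (i j : int) :
  (forall k : int, 0 <= k -> k <= N%:Z -> a (i + k) = b (j + k)) ->
  word N a i = word N b j.
Proof.
by move=> e; apply: eq_from_tnth => k; rewrite !tnth_mktuple; apply: e; have := ltn_ord k; lia.
Qed.

Section Rule.
Variables (X : set (config A)) (phi : config A -> config A).
Variables (m n : nat) (f : (m + n).+1.-tuple A -> A).
Hypothesis hf : is_of_type X phi f.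

Lemma of_typeE x (j : int) : X x -> f (word (m + n) x j) = phi x (j + m%:Z).
Proof. by move=> Xx; rewrite hf.2 // addrK. Qed.

Lemma of_type_local x y (i : int) : X x -> X y ->
  (forall j, i - m%:Z <= j -> j <= i + n%:Z -> x j = y j) -> phi x i = phi y i.
Proof.
move=> Xx Xy e; rewrite !hf.2 //; congr f; apply: eq_word => k k0 kN.
by apply: e; lia.
Qed.

Lemma left_redundantP I : left_redundant X f I <-> left_reach X phi (I%:Z - m%:Z).
Proof.
split=> hI x y Xx Xy e; have := hI x y Xx Xy e; rewrite !of_typeE //.
  by rewrite (_ : - (_ - _) = - I%:Z + m%:Z) //; lia.
by rewrite (_ : - (_ - _) = - I%:Z + m%:Z) //; lia.
Qed.

Lemma right_redundantP J : right_redundant X f J <-> right_reach X phi (J%:Z - n%:Z).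
Proof.
have E : J%:Z - (m + n)%N%:Z + m%:Z = J%:Z - n%:Z by lia.
by split=> hJ x y Xx Xy e; have := hJ x y Xx Xy e; rewrite !of_typeE // E.
Qed.

Lemma right_mergibleP k : right_mergible X f k <-> right_recovery X phi (n%:Z - k%:Z).
Proof.
split=> hk x y Xx Xy e e'; apply: hk => // j hj.
  by rewrite !of_typeE //; apply: e'; lia.
have [j0|j0] := leP j (- n%:Z).
  by apply: of_type_local => // i _ hi; apply: e; lia.
have := e' (j + n%:Z); rewrite !of_typeE //.
by rewrite (_ : _ - _ + _ = j); [apply; lia|lia].
Qed.

Lemma left_mergibleP l : left_mergible X f l <-> left_recovery X phi (m%:Z - l%:Z).
Proof.
split=> hl x y Xx Xy e e'; apply: hl => // j hj.
  by rewrite !of_typeE //; apply: e'; lia.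
have [j0|j0] := leP m%:Z j.
  by apply: of_type_local => // i hi _; apply: e; lia.
have := e' (m%:Z - j); rewrite !of_typeE //.
by rewrite (_ : - _ + _ = j); [apply; lia|lia].
Qed.
End Rule.

Lemma cellular_of_type X phi : (0 < #|A|)%N -> cellular X phi ->
  exists m n (f : (m + n).+1.-tuple A -> A), is_of_type X phi f.
Proof.
move=> /card_gt0P[a0 _] h; have [w hw] := cel_radius h.
have /choice [f hf] : forall t : (w + w).+1.-tuple A, exists c : A,
    forall x, X x -> word (w + w) x (- w%:Z) = t -> phi x 0 = c.
  move=> t; have [[x [Xx xt]]|no] :=
    pselect (exists x, X x /\ word (w + w) x (- w%:Z) = t); last first.
    by exists a0 => x Xx xt; case: no; exists x.
  exists (phi x 0) => y Xy yt; apply: hw => // j hj.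
  have kw : (absz (j + w%:Z)%R < (w + w).+1)%N by lia.
  have /(congr1 (fun s => tnth s (Ordinal kw))) : word (w + w) y (- w%:Z) = word (w + w) x (- w%:Z).
    by rewrite yt.
  by rewrite !tnth_mktuple /= (_ : - w%:Z + _ = j) //; lia.
have phiE x (j : int) : X x -> phi x j = f (word (w + w) x (j - w%:Z)).
  move=> Xx; have := hf _ _ (cel_shift h j Xx) erefl.
  rewrite (cel_comm h) // /shift add0r => ->; congr f; apply: eq_word => k _ _.
  by rewrite /shift; congr x; lia.
exists w, w, f; split => [x Xx|x Xx]; last by apply/funext => j; rewrite phiE.
rewrite (_ : (fun j => _) = shift w%:Z (phi x)); last first.
  by apply/funext => j; rewrite /shift phiE // addrK.
exact/(cel_shift h)/(cel_map h).
Qed.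

Lemma PLE X phi : (0 < #|A|)%N -> cellular X phi ->
  PL X phi = degree (left_reach X phi) :> \bar R.
Proof.
move=> A0 h; have [m [n [f hf]]] := cellular_of_type A0 h.
have main m' n' (f' : (m' + n').+1.-tuple A -> A) I : is_of_type X phi f' ->
    strictly_redundant (left_redundant X f') I ->
    (I - m'%:R%:E)%E = degree (left_reach X phi) :> \bar R.
  move=> hf'; apply: strictly_redundant_degree; last exact: left_redundantP.
  by move=> p q; apply: left_reach_down.
have [|I hI] := @strictly_redundant_ex R (left_redundant X f).
  apply/(left_redundantP hf) => x y Xx Xy e; apply: (of_type_local hf) => // j j0 _; apply: e; lia.
apply: xget_unique; first by exists m, n, f, I; split => //; rewrite (main _ _ _ _ hf hI).
by move=> v [m' [n' [f' [I' [hf' hI' ->]]]]]; apply: main hI'.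
Qed.

Lemma right_reach_down X phi p q : cellular X phi -> q <= p ->
  right_reach X phi p -> right_reach X phi q.
Proof. by rewrite !right_reachE => /cellular_mirror; apply: left_reach_down. Qed.

Lemma left_recovery_down X phi p q :
  q <= p -> left_recovery X phi p -> left_recovery X phi q.
Proof. by rewrite !left_recoveryE; apply: right_recovery_down. Qed.

Lemma PRE X phi : (0 < #|A|)%N -> cellular X phi ->
  PR X phi = degree (right_reach X phi) :> \bar R.
Proof.
move=> A0 h; have [m [n [f hf]]] := cellular_of_type A0 h.
have main m' n' (f' : (m' + n').+1.-tuple A -> A) I : is_of_type X phi f' ->
    strictly_redundant (right_redundant X f') I ->
    (I - n'%:R%:E)%E = degree (right_reach X phi) :> \bar R.
  move=> hf'; apply: strictly_redundant_degree; last exact: right_redundantP.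
  by move=> p q; apply: right_reach_down.
have [|I hI] := @strictly_redundant_ex R (right_redundant X f).
  apply/(right_redundantP hf) => x y Xx Xy e; apply: (of_type_local hf) => // j _ j0; apply: e; lia.
apply: xget_unique; first by exists m, n, f, I; split => //; rewrite (main _ _ _ _ hf hI).
by move=> v [m' [n' [f' [I' [hf' hI' ->]]]]]; apply: main hI'.
Qed.
End LocalRuleDegrees.

(** * Mergibility degrees and finite subshifts *)

Section Finiteness.
Context {R : realType} (A : finType).
Implicit Types (X : set (config A)) (phi : config A -> config A).

(** If the past determines the future then a fixed number of coordinates does, so
    the number of points is at most the number of words of that length. *)
Lemma determined_finite X phi : cellular X phi ->
  (forall x y, X x -> X y -> (forall j : int, j <= 0 -> x j = y j) -> x 1 = y 1) ->
  finite_set X.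
Proof.
move=> h det; have [w hw] : exists w : nat, forall x y, X x -> X y ->
    (forall j : int, - w%:Z <= j -> j <= 0 -> x j = y j) -> x 1 = y 1.
  apply: contrapT => /forallNP no.
  have [|x [y [Xx Xy e ne]]] := @point_limit _ X phi (fun i j => i = 0%N /\ j < 0) h.
    move=> T; have /existsNP[x /existsNP[y]] := no T.
    move=> /not_implyP[Xx /not_implyP[Xy /not_implyP[e ne]]].
    exists (shift 1 x), (shift 1 y); split; try exact: cel_shift h _ _ _.
      by move=> i j _ hj [-> j0] /=; apply: e; lia.
    by rewrite /shift add0r.
  apply: ne; have := det _ _ (cel_shift h (-1) Xx) (cel_shift h (-1) Xy).
  by apply=> j j0; apply: (e 0%N); split => //; lia.
have grow x y (c : int) : X x -> X y ->
    (forall j : int, c - w%:Z <= j -> j <= c -> x j = y j) ->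
    forall j : int, c - w%:Z <= j -> x j = y j.
  move=> Xx Xy e.
  have step (k : nat) (j : int) : c - w%:Z <= j -> j <= c + k%:Z -> x j = y j.
    elim: k j => [|k IH] j cj jk; first by apply: e; lia.
    have [jk'|jk'] := leP j (c + k%:Z); first exact: IH.
    have := hw _ _ (cel_shift h (j - 1) Xx) (cel_shift h (j - 1) Xy).
    rewrite /shift (_ : 1 + (j - 1) = j); last by lia.
    by apply=> i wi i0; apply: IH; lia.
  by move=> j cj; apply: (step (absz (j - c)%R)); lia.
apply: contrapT => /infiniteP /card_leP[f0].
pose f n : config A := \val (f0 (to_setT n)).
have Xf n : X (f n) by have := valP (f0 (to_setT n)); rewrite inE.
have finj : injective f.
  move=> i j /val_inj /(@inj _ _ _ f0); rewrite !inE => /(_ I I).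
  by move=> /(congr1 \val).
pose K := #|{: w.+1.-tuple A}|.
have /choice [e he] : forall p : 'I_K.+1 * 'I_K.+1, exists c : int,
    p.1 != p.2 -> f p.1 c <> f p.2 c.
  move=> [i i'] /=; have [eq|ne] := eqVneq i i'; first by exists 0.
  apply: contrapT => /forallNP no; move/eqP: ne; apply; apply/val_inj.
  apply: finj; apply/funext => j; apply: contrapT => nj.
  exact: no j (fun _ => nj).
(* Left of [- M] no coordinate is needed to tell the [f i] apart. *)
pose M := \max_p absz (e p).
pose g (i : 'I_K.+1) := word w (f i) (- M%:Z - w%:Z).
have ginj : injective g.
  move=> i i' gi; apply/eqP; apply: contrapT => /negP ne.
  apply: (he (i, i') ne) => /=; apply: (grow _ _ (- M%:Z)) => //.
    move=> j lo hi; have kw : (absz (j + M%:Z + w%:Z)%R < w.+1)%N by lia.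
    have := congr1 (fun s => tnth s (Ordinal kw)) gi.
    by rewrite !tnth_mktuple /= (_ : - M%:Z - w%:Z + _ = j) //; lia.
  have : (absz (e (i, i')) <= M)%N by exact: (leq_bigmax (i, i')).
  lia.
by have := leq_card g ginj; rewrite card_ord ltnn.
Qed.

(** Finitely many points are separated by the coordinates below some [M], and a
    shift moves these to the left of the origin. *)
Lemma finite_determined X phi x y : cellular X phi -> finite_set X -> X x -> X y ->
  (forall j : int, j <= 0 -> x j = y j) -> x = y.
Proof.
move=> h /finite_seqP[s sX].
have /choice [e he] : forall p : config A * config A, exists c : int,
    p.1 <> p.2 -> p.1 c <> p.2 c.
  move=> [a b] /=; have [eq|ne] := pselect (a = b); first by exists 0.
  apply: contrapT => /forallNP no; apply: ne; apply/funext => j; apply: contrapT => nj.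
  exact: no j (fun _ => nj).
pose M := \max_(p <- [seq (a, b) | a <- s, b <- s]) absz (e p).
have sep a b : X a -> X b -> (forall j : int, j <= M%:Z -> a j = b j) -> a = b.
  rewrite sX /= => sa sb eab; apply: contrapT => /(he (a, b)) /=; apply; apply: eab.
  have : (absz (e (a, b)) <= M)%N.
    by apply: leq_bigmax_seq => //; apply/allpairsP; exists (a, b).
  lia.
move=> Xx Xy exy; apply: (@shift_inj A (- M%:Z)).
apply: sep; try exact: cel_shift h _ _ _.
by move=> j jM; apply: exy; lia.
Qed.

(** The convention for finite [X] is the value of the supremum: there the past
    determines the point, so every number of cells is recovered. *)
Lemma QRE X phi : (0 < #|A|)%N -> cellular X phi ->
  QR X phi = degree (right_recovery X phi) :> \bar R.
Proof.
move=> A0 h; rewrite /QR; case: asboolP => [fin|inf].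
  apply/esym/eq_infty => r.
  apply: (@le_trans _ _ (Num.floor r + 1)%:~R%:E).
    by rewrite lee_fin ltW // floorD1_gt.
  apply: ereal_sup_ubound; exists (Num.floor r + 1) => // x y Xx Xy e _.
  by rewrite (finite_determined h fin Xx Xy e).
have [m [n [f hf]]] := cellular_of_type A0 h.
have main m' n' (f' : (m' + n').+1.-tuple A -> A) k : is_of_type X phi f' ->
    strictly_mergible (right_mergible X f') k ->
    (n'%:R%:E - k)%E = degree (right_recovery X phi) :> \bar R.
  move=> hf'; apply: strictly_mergible_degree; [|exact: right_mergibleP|].
    by move=> p q; apply: right_recovery_down.
  move=> top; apply: inf; apply: (determined_finite h) => x y Xx Xy e.
  apply: top => // j hj; apply: (of_type_local hf') => // i _ hi; apply: e; lia.
have [k hk] := @strictly_mergible_ex R (right_mergible X f).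
apply: xget_unique; first by exists m, n, f, k; split => //; rewrite (main _ _ _ _ hf hk).
by move=> v [m' [n' [f' [k' [hf' hk' ->]]]]]; apply: main hk'.
Qed.

Lemma mirror_finite X : finite_set (mirror_set X) -> finite_set X.
Proof.
move=> fin; have := finite_image (@mirror A) fin; apply: sub_finite_set => x Xx.
by exists (mirror x); rewrite ?/mirror_set /= mirrorK.
Qed.

Lemma QLE X phi : (0 < #|A|)%N -> cellular X phi ->
  QL X phi = degree (left_recovery X phi) :> \bar R.
Proof.
move=> A0 h; rewrite /QL; case: asboolP => [fin|inf].
  have fin' : finite_set (mirror_set X) by apply: mirror_finite; rewrite mirror_setK.
  apply/esym/eq_infty => r.
  apply: (@le_trans _ _ (Num.floor r + 1)%:~R%:E).
    by rewrite lee_fin ltW // floorD1_gt.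
  apply: ereal_sup_ubound; exists (Num.floor r + 1) => //; rewrite left_recoveryE => x y Xx Xy e _.
  by rewrite (finite_determined (cellular_mirror h) fin' Xx Xy e).
have [m [n [f hf]]] := cellular_of_type A0 h.
have main m' n' (f' : (m' + n').+1.-tuple A -> A) k : is_of_type X phi f' ->
    strictly_mergible (left_mergible X f') k ->
    (m'%:R%:E - k)%E = degree (left_recovery X phi) :> \bar R.
  move=> hf'; apply: strictly_mergible_degree; [|exact: left_mergibleP|].
    by move=> p q; apply: left_recovery_down.
  move=> top; apply: inf; apply/mirror_finite/(determined_finite (cellular_mirror h)).
  move=> x y Xx Xy e; apply: (top (mirror x) (mirror y)) => // j hj.
    by apply: e; lia.
  apply: (of_type_local hf') => // i hi _; apply: e; lia.
have [k hk] := @strictly_mergible_ex R (left_mergible X f).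
apply: xget_unique; first by exists m, n, f, k; split => //; rewrite (main _ _ _ _ hf hk).
by move=> v [m' [n' [f' [k' [hf' hk' ->]]]]]; apply: main hk'.
Qed.

(** * The limits of the degrees *)

Section Growth.
Variables (X : set (config A)) (phi : config A -> config A).
Hypotheses (A0 : (0 < #|A|)%N) (h : cellular X phi).

Lemma growthE (D : (config A -> config A) -> \bar R) (P : nat -> int -> Prop) :
  (forall s, D (iter s phi) = degree (P s)) -> P 0%N 0 ->
  (forall s t p q, P s p -> P t q -> P (s + t)%N (p + q)) ->
  (forall s p, (0 < s)%N -> P s p -> exists p1, P 1%N p1) ->
  growth D phi = slope_sup P.
Proof.
move=> DE P0 PD P1; rewrite /growth.
have -> : (fun s : nat => (D (iter s phi) * (s%:R^-1)%:E)%E) =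
    (fun s => (degree (P s) * (s%:R^-1)%:E)%E).
  by apply/funext => s; rewrite DE.
by apply: cvg_lim => //; apply: cvg_degree_slope.
Qed.

Lemma pLE : pL R X phi = left_reach_rate X phi.
Proof.
apply: growthE => [s||s t p q|s p _ _].
- exact: PLE A0 (cellular_iter s h).
- exact: left_reach0.
- exact: left_reachD.
- exact: left_reach1.
Qed.

Lemma qRE : qR R X phi = right_recovery_rate X phi.
Proof.
apply: growthE => [s||s t p q|s p s0 hp].
- exact: QRE A0 (cellular_iter s h).
- exact: right_recovery0.
- exact: right_recoveryD.
- exact: right_closing_right_recovery h (recovery_right_closing h s0 hp).
Qed.

Lemma pRE : pR R X phi = right_reach_rate X phi.
Proof.
have h' := cellular_mirror h.
apply: growthE => [s||s t p q|s p _ _]; rewrite ?right_reachE -?iter_mirror.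
- by rewrite (PRE A0 (cellular_iter s h)) ?right_reachE iter_mirror.
- exact: left_reach0.
- exact: left_reachD.
- exact: left_reach1 h'.
Qed.

Lemma qLE : qL R X phi = left_recovery_rate X phi.
Proof.
have h' := cellular_mirror h.
apply: growthE => [s||s t p q|s p s0]; rewrite ?left_recoveryE -?iter_mirror.
- by rewrite (QLE A0 (cellular_iter s h)) ?left_recoveryE iter_mirror.
- exact: right_recovery0.
- exact: right_recoveryD.
- by move=> hp; exact: right_closing_right_recovery h' (recovery_right_closing h' s0 hp).
Qed.
End Growth.
End Finiteness.

(** * The expansive directions *)

Theorem theorem11p8 (R : realType) (A : finType) (hA : (1 < #|A|)%N)
    (X : set (config A)) (hX : subshift X)
    (d : config A -> config A -> R) (hd : compatible_metric X d)
    (phi : config A -> config A) (hphi : endomorphism X phi) :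
  (onto X phi ->
    ((* (1) *)
     ((interv (- pL R X phi)%E +oo%E = right_expansive_upper X phi d /\
       is_right_unbounded_component (right_expansive X phi d)
         (interv (- pL R X phi)%E +oo%E)) /\
      (interv -oo%E (pR R X phi) = left_expansive_upper X phi d /\
       is_left_unbounded_component (left_expansive X phi d)
         (interv -oo%E (pR R X phi)))) /\
     (* (2) *)
     ((interv (- qR R X phi)%E +oo%E = pos_left_expansive X phi d /\
       (interv (- qR R X phi)%E +oo%E !=set0 ->
        is_right_unbounded_component (left_expansive X phi d)
          (interv (- qR R X phi)%E +oo%E))) /\
      (interv -oo%E (qL R X phi) = pos_right_expansive X phi d /\
       (interv -oo%E (qL R X phi) !=set0 ->
        is_left_unbounded_component (right_expansive X phi d)
          (interv -oo%E (qL R X phi))))) /\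
     (* (3) *)
     ((forall r : R, r%:E = (- pL R X phi)%E \/ r%:E = qL R X phi ->
         ~ right_expansive X phi d r) /\
      (forall r : R, r%:E = pR R X phi \/ r%:E = (- qR R X phi)%E ->
         ~ left_expansive X phi d r)) /\
     (* (4) *)
     ((interv (cR R X phi) +oo%E !=set0 ->
        is_right_unbounded_component (expansive X phi d)
          (interv (cR R X phi) +oo%E)) /\
      (interv -oo%E (cL R X phi) !=set0 ->
        is_left_unbounded_component (expansive X phi d)
          (interv -oo%E (cL R X phi))) /\
      (interv (- qR R X phi)%E (qL R X phi) !=set0 ->
        is_component (expansive X phi d)
          (interv (- qR R X phi)%E (qL R X phi)))))) /\
  (* (5) *)
  (interv (- qR R X phi)%E +oo%E = pos_left_expansive X phi d /\
   interv -oo%E (qL R X phi) = pos_right_expansive X phi d /\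
   interv (- qR R X phi)%E (qL R X phi) = pos_expansive X phi d).
Proof.
have A0 : (0 < #|A|)%N by exact: ltnW.
have h := endomorphism_cellular hX hphi.
rewrite /cR /cL (pLE A0 h) (pRE A0 h) (qRE A0 h) (qLE A0 h).
set pl := left_reach_rate X phi; set pr := right_reach_rate X phi.
set qr := right_recovery_rate X phi; set ql := left_recovery_rate X phi.
have upR r : right_expansive_upper X phi d r <-> (- pl < r%:E)%E.
  by rewrite right_expansive_upperE // right_sep_upP.
have upL r : left_expansive_upper X phi d r <-> (r%:E < pr)%E.
  by rewrite left_expansive_upperE // left_sep_upP.
have posL r : pos_left_expansive X phi d r <-> (- qr < r%:E)%E.
  by rewrite pos_left_expansiveE // pos_left_sepP.
have posR r : pos_right_expansive X phi d r <-> (r%:E < ql)%E.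
  by rewrite pos_right_expansiveE // pos_right_sepP.
have subRR r : (- pl < r%:E)%E -> right_expansive X phi d r.
  by move=> lt; rewrite right_expansiveE //; apply: right_sep_up_sep => //; apply/right_sep_upP.
have subLL r : (r%:E < pr)%E -> left_expansive X phi d r.
  by move=> lt; rewrite left_expansiveE //; apply: left_sep_up_sep => //; apply/left_sep_upP.
have subLR r : (- qr < r%:E)%E -> left_expansive X phi d r.
  by move=> lt; rewrite left_expansiveE //; apply: pos_left_sep_orbit => //; apply/pos_left_sepP.
have subRL r : (r%:E < ql)%E -> right_expansive X phi d r.
  by move=> lt; rewrite right_expansiveE //; apply: pos_right_sep_orbit => //; apply/pos_right_sepP.
have expE r : expansive X phi d r <-> left_expansive X phi d r /\ right_expansive X phi d r.
  by rewrite expansiveE // strip_sepP // left_expansiveE // right_expansiveE.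
have endRR r : r%:E = (- pl)%E -> ~ right_expansive X phi d r.
  move=> e; rewrite right_expansiveE // -[r]opprK; apply: right_sep_critical => //.
  by rewrite -/pl -[pl]oppeK -e.
have endRL r : r%:E = ql -> ~ right_expansive X phi d r.
  by move=> e; rewrite right_expansiveE //; apply: right_sep_recovery_critical.
have endLL r : r%:E = pr -> ~ left_expansive X phi d r.
  by move=> e; rewrite left_expansiveE //; apply: left_sep_reach_critical.
have endLR r : r%:E = (- qr)%E -> ~ left_expansive X phi d r.
  move=> e; rewrite left_expansiveE // -[r]opprK.
  by apply: (left_sep_critical (R := R) h _).1; rewrite -/qr -[qr]oppeK -e.
have ray_right (a : \bar R) (E : set R) : (forall r, E r <-> (a < r%:E)%E) -> interv a +oo%E = E.
  move=> EP; apply/seteqP; split=> r; first by case=> ? _; apply/EP.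
  by move=> /EP; split; rewrite ?ltry.
have ray_left (a : \bar R) (E : set R) : (forall r, E r <-> (r%:E < a)%E) -> interv -oo%E a = E.
  move=> EP; apply/seteqP; split=> r; first by case=> _ ?; apply/EP.
  by move=> /EP; split; rewrite ?ltNyr.
have eqL := ray_right _ _ posL; have eqR := ray_left _ _ posR.
have lty (a b : \bar R) : interv a b !=set0 -> (a < +oo)%E /\ (-oo < b)%E.
  move=> [x [ax xb]]; split; first exact: lt_le_trans ax (leey _).
  exact: le_lt_trans (leNye _) xb.
split; last first.
  split=> //; split=> //; apply/seteqP; split=> r.
    move=> [h1 h2]; rewrite pos_expansiveE // pos_strip_sepP //.
    by split; [apply/pos_left_sepP|apply/pos_right_sepP].
  rewrite /mkset pos_expansiveE // pos_strip_sepP // => -[h1 h2].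
  by split; [apply/pos_left_sepP|apply/pos_right_sepP].
move=> _; split; [|split; [|split]].
- split; split.
  + exact: ray_right.
  + apply: interv_right_component => //.
      by rewrite lteNl; exact: left_reach_rate_gt.
    by move=> r [? _]; apply: subRR.
  + exact: ray_left.
  + apply: interv_left_component => //; first exact: right_reach_rate_gt.
    by move=> r [_ ?]; apply: subLL.
- split; split=> //.
  + move=> /lty[ay _]; apply: interv_right_component => //.
    by move=> r [? _]; apply: subLR.
  + move=> /lty[_ yb]; apply: interv_left_component => //.
    by move=> r [_ ?]; apply: subRL.
- by split=> r [e|e]; auto.
- split; [|split].
  + move=> /lty[ay _]; apply: interv_right_component => //.
      move=> r []; rewrite gt_max => /andP[h1 h2] _; apply/expE.
      by split; [apply: subLR|apply: subRR].
    move=> r; case: leP => _ e /expE[]; [move=> /(endLR _ e) //|move=> _; exact: endRR].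
  + move=> /lty[_ yb]; apply: interv_left_component => //.
      move=> r []; rewrite lt_min => _ /andP[h1 h2]; apply/expE.
      by split; [apply: subLL|apply: subRL].
    move=> r; case: leP => _ e /expE[]; [move=> /(endLL _ e) //|move=> _; exact: endRL].
  + move=> ne; apply: interv_is_component => //.
      by move=> r [h1 h2]; apply/expE; split; [apply: subLR|apply: subRL].
    by move=> r [e|e] /expE[]; [move=> /(endLR _ e)|move=> _; exact: endRL].
Qed.
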